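(* Let $K=\mathbb C$, $m\ge0$, $V_{\mathbb C}=\mathbb C^m$ with its standard symmetric bilinear form $(\cdot,\cdot)$ and $\mathfrak g=\mathfrak{so}_m\simeq\Lambda^2V_{\mathbb C}$. The specialized PBW deformation maps $\{F_{m,0}(\kappa^{(-1,w)}) : w\ge0 \text{ odd}\}$ are the same as the PBW deformation maps of type $(O_m,\mathbb C^m,-1)$ found by Tsymbaliuk. That is: identify $S^w\mathfrak g\simeq S^w\mathfrak g^*$ (homogeneous polynomial functions of degree $w$ on $\mathfrak g$) by means of the trace form $X\otimes Y\mapsto\mathrm{tr}(XY)$. Then for every $N\ge0$, the map $F_{m,0}(\kappa^{(-1,2N+1)})\colon\Lambda^2V_{\mathbb C}\to S^{2N+1}\mathfrak g\simeq S^{2N+1}\mathfrak g^*$ is, up to a non-zero scalar, the map sending $v_1\otimes v_2$ to the polynomial function on $\mathfrak g$ whose value at $A\in\mathfrak g$ is the coefficient of $\tau^{2N}$ in the expansion of $$\big(v_2,\,A(1+\tau^2A^2)^{-1}v_1\big)\,\det(1+\tau^2A^2)^{-1/2}.$$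
   Context: **Category.** Let $t=m$. For $k,\ell\ge0$, $A^k_\ell$ is the set of arc diagrams with $k$ upper and $\ell$ lower points (numbered left to right), i.e. perfect matchings of the $k+\ell$ points. The Brauer category with parameter $t$ has objects $V^{\otimes k}$ ($k\ge0$), $\mathrm{Hom}(V^{\otimes k},V^{\otimes\ell})$ is the $\mathbb C$-vector space with basis $A^k_\ell$, composition is vertical stacking (source on top, target at the bottom) with each closed loop replaced by a factor $t$, the tensor product is horizontal juxtaposition, and the symmetric braiding is determined by the crossing $c_{V,V}$. $\underline{\mathrm{Rep}}(O_t)$ is its additive and idempotent completion. For an object $X$, $T^nX=X^{\otimes n}$, $S^{\pm n}X$ is the image of $\sum_{\sigma\in S_n}(\pm1)^\sigma\sigma$ acting on $T^nX$ via the braiding (with $1^\sigma=1$, $(-1)^\sigma$ the sign), and $\Lambda^nX=S^{-n}X$. $s_d$ is the endomorphism of $T^{2d}V=T^d(T^2V)$ equal to $\sum_{\sigma\in S_d}\sigma\circ(\mathrm{id}-c_{V,V})^{\otimes d}$, with $\sigma$ permuting the $d$ factors $T^2V$; its image is $S^d\Lambda^2V$. **The maps $\kappa^{(\rho,w)}$.** A partition $\nu$ is a finite weakly decreasing sequence of positive integers, $\#\nu$ is the number of parts, $|\nu|$ their sum, $m_\nu(\ell)$ the multiplicity of $\ell$; $P^+$ is the set of partitions with only even parts. For $M\ge0$ and $\nu\in P^+$ let $x_{M,\nu}\in A^2_{2(M+|\nu|)}$ be the following diagram: if $M=0$ the two upper points $a,b$ are joined by an arc; if $M\ge1$, then with $q_1,\dots,q_{2M}$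 the first $2M$ lower points there are the arcs $\{a,q_1\},\{q_2,q_3\},\dots,\{q_{2M-2},q_{2M-1}\},\{q_{2M},b\}$; then each part $\ell$ of $\nu$ in turn uses the next $2\ell$ lower points $q_1,\dots,q_{2\ell}$ with arcs $\{q_2,q_3\},\dots,\{q_{2\ell-2},q_{2\ell-1}\},\{q_1,q_{2\ell}\}$. For $\rho\in\{\pm1\}$ and $w\ge0$ with $(-1)^w=\rho$ put $$\kappa^{(\rho,w)}=\sum_{\nu\in P^+,\,|\nu|\le w}\frac{(-\rho)^{\#\nu}}{\prod_{i=1}^{\#\nu}\nu_i\,\prod_{\ell\ge1}m_\nu(\ell)!}\;s_w\circ(2x_{w-|\nu|,\nu})|_{S^{2\rho}V}\in\mathrm{Hom}(S^{2\rho}V,S^w\Lambda^2V).$$ **Specialization.** $F_{m,0}\colon\underline{\mathrm{Rep}}(O_t)\to\mathrm{Vec}_{\mathbb C}$ is the $\mathbb C$-linear symmetric monoidal functor sending $V$ to $V_{\mathbb C}=\mathbb C^m$ with standard basis $e_1,\dots,e_m$, the one-arc diagram $\cup\colon V\otimes V\to\mathbf 1$ to the form $e_i\otimes e_j\mapsto\delta_{ij}$ and the one-arc diagram $\cap\colon\mathbf 1\to V\otimes V$ to $1\mapsto\sum_ie_i\otimes e_i$. The form identifies $V_{\mathbb C}\otimes V_{\mathbb C}\simeq\mathfrak{gl}(V_{\mathbb C})$, under which $\Lambda^2V_{\mathbb C}$ becomes $\mathfrak g=\mathfrak{so}_m$. *)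

(* Defs.v *)
From HB Require Import structures.
From mathcomp Require Import all_boot all_order all_algebra all_fingroup.
From mathcomp Require Import reals.
From mathcomp Require Export complex.
From mathcomp Require Import mxtens zify.

Set Implicit Arguments.
Unset Strict Implicit.
Unset Printing Implicit Defensive.

Import Order.TTheory GRing.Theory Num.Theory.

Local Open Scope ring_scope.

(* A perfect matching of the [k] upper points [inl i] and the [l] lower points
   [inr j] is the fixed-point-free involution exchanging the ends of each arc *)
Record arcdiag (k l : nat) := ArcDiag {
  partner :> {ffun 'I_k + 'I_l -> 'I_k + 'I_l};
  _ : [forall p, (partner (partner p) == p) && (partner p != p)] }.

HB.instance Definition _ k l := [isSub for @partner k l].
HB.instance Definition _ k l := [Finite of arcdiag k l by <:].

Lemma partnerP k l (D : arcdiag k l) p : D (D p) = p /\ D p != p.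
Proof. by case: D => f /= /forallP/(_ p)/andP[/eqP]. Qed.

Lemma mk_arcdiag_proof k l (f : 'I_k + 'I_l -> 'I_k + 'I_l) :
  involutive f -> (forall p, f p != p) ->
  [forall p, (finfun f (finfun f p) == p) && (finfun f p != p)].
Proof. by move=> fK fN; apply/forallP => p; rewrite !ffunE fK eqxx fN. Qed.

Definition mk_arcdiag k l f fK fN : arcdiag k l :=
  ArcDiag (@mk_arcdiag_proof k l f fK fN).

Section Diagrams.

Definition perm_pt n (s : 'S_n) (p : 'I_n + 'I_n) : 'I_n + 'I_n :=
  match p with inl i => inr (s i) | inr j => inl ((s^-1)%g j) end.

Lemma perm_ptK n (s : 'S_n) : involutive (perm_pt s).
Proof. by case=> i /=; rewrite ?permK ?permKV. Qed.

Lemma perm_ptN n (s : 'S_n) p : perm_pt s p != p.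
Proof. by case: p. Qed.

Definition perm_diag n (s : 'S_n) : arcdiag n n :=
  mk_arcdiag (perm_ptK s) (perm_ptN s).

Lemma ord2_revN (i : 'I_2) : rev_ord i != i.
Proof. by case: i => [[|[|]]]. Qed.

Definition cup_pt (p : 'I_2 + 'I_0) : 'I_2 + 'I_0 :=
  if p is inl i then inl (rev_ord i) else p.

Lemma cup_ptK : involutive cup_pt.
Proof. by case=> [i|[]] //=; rewrite rev_ordK. Qed.

Lemma cup_ptN p : cup_pt p != p.
Proof. by case: p => [i|[]] //; apply: (contra_neq _ (ord2_revN i)) => -[]. Qed.

Definition cup_diag : arcdiag 2 0 := mk_arcdiag cup_ptK cup_ptN.

Definition cap_pt (p : 'I_0 + 'I_2) : 'I_0 + 'I_2 :=
  if p is inr i then inr (rev_ord i) else p.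

Lemma cap_ptK : involutive cap_pt.
Proof. by case=> [[]|i] //=; rewrite rev_ordK. Qed.

Lemma cap_ptN p : cap_pt p != p.
Proof. by case: p => [[]|i] //; apply: (contra_neq _ (ord2_revN i)) => -[]. Qed.

Definition cap_diag : arcdiag 0 2 := mk_arcdiag cap_ptK cap_ptN.

Section Juxtaposition.
Variables k1 l1 k2 l2 : nat.

Definition juxt (p : ('I_k1 + 'I_l1) + ('I_k2 + 'I_l2)) :
    'I_(k1 + k2) + 'I_(l1 + l2) :=
  match p with
  | inl (inl i) => inl (lshift k2 i)
  | inl (inr j) => inr (lshift l2 j)
  | inr (inl i) => inl (rshift k1 i)
  | inr (inr j) => inr (rshift l1 j)
  end.

Definition unjuxt (p : 'I_(k1 + k2) + 'I_(l1 + l2)) :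
    ('I_k1 + 'I_l1) + ('I_k2 + 'I_l2) :=
  match p with
  | inl i => match split i with inl a => inl (inl a) | inr b => inr (inl b) end
  | inr j => match split j with inl a => inl (inr a) | inr b => inr (inr b) end
  end.

Lemma juxtK : cancel juxt unjuxt.
Proof.
by case=> [[]|[]] i; rewrite /= ?(unsplitK (inl i)) ?(unsplitK (inr i)).
Qed.

Lemma unjuxtK : cancel unjuxt juxt.
Proof. by case=> i /=; rewrite -[in RHS](splitK i); case: split. Qed.

Definition juxt_pt (D : arcdiag k1 l1) (E : arcdiag k2 l2) p :=
  juxt (match unjuxt p with inl q => inl (D q) | inr q => inr (E q) end).

Lemma juxt_ptK D E : involutive (juxt_pt D E).
Proof.
move=> p; rewrite /juxt_pt juxtK -[RHS]unjuxtK.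
by case: (unjuxt p) => q; rewrite (partnerP _ q).1.
Qed.

Lemma juxt_ptN D E p : juxt_pt D E p != p.
Proof.
rewrite /juxt_pt -[X in _ != X]unjuxtK (can_eq juxtK).
case: (unjuxt p) => q.
- by apply: contra_neq (partnerP D q).2 => -[].
- by apply: contra_neq (partnerP E q).2 => -[].
Qed.

Definition juxt_diag D E : arcdiag (k1 + k2) (l1 + l2) :=
  mk_arcdiag (juxt_ptK D E) (juxt_ptN D E).

End Juxtaposition.

Section Stacking.
Variables k l n : nat.

(* The points of the stacked diagram: source, middle and target row *)
Local Notation pts := (('I_k + 'I_l) + 'I_n)%type.

Definition stack_top (p : 'I_k + 'I_l) : pts := inl p.

Definition stack_bot (q : 'I_l + 'I_n) : pts :=
  match q with inl j => inl (inr j) | inr i => inr i end.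

Definition stack_out (p : 'I_k + 'I_n) : pts :=
  match p with inl i => inl (inl i) | inr j => inr j end.

Variables (D : arcdiag k l) (E : arcdiag l n).

Definition stack_edge : rel pts := fun x y =>
  [exists p, (x == stack_top p) && (y == stack_top (D p))] ||
  [exists q, (x == stack_bot q) && (y == stack_bot (E q))].

Definition stack_loops : nat :=
  n_comp stack_edge
    [pred x | [forall p, ~~ connect stack_edge x (stack_out p)]].

(* Each component of the stack that is not a loop contains exactly two outer
   points, so exactly one matching [G] of the outer points passes this test *)
Definition stack_reduces (G : arcdiag k n) : bool :=
  [forall p, connect stack_edge (stack_out p) (stack_out (G p))].

End Stacking.

(* Points of a diagram named by their position, so as to list arcs *)
Definition pt_pos k l (p : 'I_k + 'I_l) : nat + nat :=
  match p with inl i => inl (val i) | inr j => inr (val j) end.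

Definition has_arcs k l (D : arcdiag k l) (s : seq ((nat + nat) * (nat + nat))) :=
  all (fun a => [exists p, (pt_pos p == a.1) && (pt_pos (D p) == a.2)]) s.

(* Positions start at 0, so the point q_i of a block starting at [off] is
   [inr (off + i - 1)], and the arc {q_(2j), q_(2j+1)} is [inner_arc off j] *)
Definition inner_arc (off j : nat) : (nat + nat) * (nat + nat) :=
  (inr (off + j.*2.-1)%N, inr (off + j.*2)%N).

Definition path_arcs (M : nat) : seq ((nat + nat) * (nat + nat)) :=
  if M == 0%N then [:: (inl 0%N, inl 1%N)]
  else (inl 0%N, inr 0%N) :: [seq inner_arc 0 j | j <- iota 1 M.-1]
       ++ [:: (inr M.*2.-1, inl 1%N)].

Definition cycle_arcs (off l : nat) : seq ((nat + nat) * (nat + nat)) :=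
  (inr off, inr (off + l.*2.-1)%N) :: [seq inner_arc off j | j <- iota 1 l.-1].

Fixpoint cycles_arcs (off : nat) (nu : seq nat) :=
  if nu is l :: nu' then cycle_arcs off l ++ cycles_arcs (off + l.*2) nu'
  else [::].

Definition x_arcs (M : nat) (nu : seq nat) :=
  path_arcs M ++ cycles_arcs M.*2 nu.

End Diagrams.

Section Brauer.
Variable (K : fieldType).

Definition bhom (k l : nat) := {ffun arcdiag k l -> K^o}.

Definition bdiag k l (D : arcdiag k l) : bhom k l := [ffun G => (G == D)%:R].

Definition bid n : bhom n n := bdiag (perm_diag 1%g).

Definition bcross : bhom 2 2 := bdiag (perm_diag (tperm ord0 ord_max)).

Definition bcup : bhom 2 0 := bdiag cup_diag.

Definition bcap : bhom 0 2 := bdiag cap_diag.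

Definition btens k1 l1 k2 l2 (f : bhom k1 l1) (g : bhom k2 l2) :
    bhom (k1 + k2) (l1 + l2) :=
  \sum_D \sum_E (f D * g E) *: bdiag (juxt_diag D E).

Fixpoint btpow k l (f : bhom k l) (d : nat) : bhom (d * k) (d * l) :=
  if d is d'.+1 then btens f (btpow f d') else bid 0.

Section Composition.
Variable t : K.

Definition stack_diag k l n (E : arcdiag l n) (D : arcdiag k l) : bhom k n :=
  \sum_(G | stack_reduces D E G) t ^+ stack_loops D E *: bdiag G.

(* [g] after [f] *)
Definition bcomp k l n (g : bhom l n) (f : bhom k l) : bhom k n :=
  \sum_D \sum_E (f D * g E) *: stack_diag E D.

Definition block_pt (d e : nat) (s : 'S_d) (i : 'I_(d * e)) : 'I_(d * e) :=
  mxtens_index (s (mxtens_unindex i).1, (mxtens_unindex i).2).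

Lemma block_pt_inj d e (s : 'S_d) : injective (@block_pt d e s).
Proof.
move=> i j /(can_inj (@mxtens_indexK d e))[/perm_inj e1 e2].
apply: (can_inj (@mxtens_unindexK d e)); apply: injective_projections => //; exact: val_inj.
Qed.

(* [s] permuting [d] consecutive blocks of [e] points *)
Definition block_perm d e (s : 'S_d) : 'S_(d * e) := perm (@block_pt_inj d e s).

Definition bsym_wedge (d : nat) : bhom (d * 2) (d * 2) :=
  \sum_(s : 'S_d)
    bcomp (bdiag (perm_diag (block_perm 2 s))) (btpow (bid 2 - bcross) d).

(* The sum over [s] of (+-1)^s s on the [n]-th tensor power of the generator;
   [rho ^+ s] is 1 if [rho = 1] and the sign of [s] if [rho = -1] *)
Definition bsymmetrizer (rho : K) (n : nat) : bhom n n :=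
  \sum_(s : 'S_n) rho ^+ s *: bdiag (perm_diag s).

(* The idempotent with the same image as [bsymmetrizer rho n], which represents
   that image in the idempotent completion *)
Definition bsym_idem (rho : K) (n : nat) : bhom n n :=
  n`!%:R^-1 *: bsymmetrizer rho n.

(* For [l = 2 (M + sumn nu)] the sum has one term: see [x_arcs_unique] *)
Definition x_hom (l M : nat) (nu : seq nat) : bhom 2 l :=
  \sum_(D : arcdiag 2 l | has_arcs D (x_arcs M nu)) bdiag D.

Definition even_partition (nu : seq nat) : bool :=
  sorted geq nu && all (fun l => (0 < l)%N && ~~ odd l) nu.

Definition kappa_coef (rho : K) (nu : seq nat) : K :=
  (- rho) ^+ size nu /
  ((\prod_(l <- nu) l) *
   \prod_(1 <= l < (sumn nu).+1) (count_mem l nu)`!)%N%:R.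

(* A morphism between the images of two idempotents [e] and [e'] is a morphism
   [f] with [e' f e = f], and restricting a morphism to the image of [e] is
   composing it with [e]; here [e] is [bsym_idem rho 2]. The parts of a partition
   of size at most [w] are at most [w], and their number [n] is at most [w]. *)
Definition kappa (rho : K) (w : nat) : bhom 2 (w * 2) :=
  \sum_(n < w.+1)
  \sum_(u : n.-tuple 'I_w.+1 |
        let nu := map val u in even_partition nu && (sumn nu <= w)%N)
    let nu := map val u in
    kappa_coef rho nu *:
    bcomp (bsym_wedge w)
          (bcomp (2%:R *: x_hom (w * 2) (w - sumn nu) nu) (bsym_idem rho 2)).

End Composition.
End Brauer.

Section Specialization.
Variables (K : fieldType) (m : nat).

(* The [k]-th tensor power of [K ^ m], in coordinates: [u i] is the coefficient
   of e_(i 0) (x) ... (x) e_(i (k - 1)) in [u] *)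
Definition tpower (k : nat) := {ffun {ffun 'I_k -> 'I_m} -> K^o}.

Definition tmul k l (u : tpower k) (v : tpower l) : tpower (k + l) :=
  [ffun i : {ffun 'I_(k + l) -> 'I_m} =>
     u [ffun a => i (lshift l a)] * v [ffun b => i (rshift k b)]].

Definition tone : tpower 0 := [ffun=> 1].

Definition tvec (v : 'cV[K]_m) : tpower 1 :=
  [ffun i : {ffun 'I_1 -> 'I_m} => v (i ord0) 0].

Definition tbase (i : 'I_m) : tpower 1 := tvec (delta_mx i 0).

Definition tmul2 (u v : tpower 1) : tpower 2 := tmul u v.

(* A symmetric monoidal functor preserves the braiding of every pair of objects
   as soon as it preserves the crossing, which determines the braiding. These
   conditions determine the functor; [specialization0] below satisfies them. *)
Record specialization := Specialization {
  spec_fun :> forall k l, {linear bhom K k l -> 'Hom(tpower k, tpower l)};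
  spec_id k : spec_fun k k (bid K k) = \1%VF;
  spec_comp k l n (g : bhom K l n) (f : bhom K k l) :
    spec_fun k n (bcomp m%:R g f) = (spec_fun l n g \o spec_fun k l f)%VF;
  spec_tens k1 l1 k2 l2 (f : bhom K k1 l1) (g : bhom K k2 l2)
      (u : tpower k1) (v : tpower k2) :
    spec_fun _ _ (btens f g) (tmul u v) =
    tmul (spec_fun _ _ f u) (spec_fun _ _ g v);
  spec_cross (u v : tpower 1) :
    spec_fun _ _ (bcross K) (tmul2 u v) = tmul2 v u;
  spec_cup (i j : 'I_m) :
    spec_fun _ _ (bcup K) (tmul2 (tbase i) (tbase j)) = (i == j)%:R *: tone;
  spec_cap :
    spec_fun _ _ (bcap K) tone = \sum_(i < m) tmul2 (tbase i) (tbase i) }.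

(* The form identifies e_i (x) e_j with the endomorphism x |-> (e_j, x) e_i,
   whose matrix is [delta_mx i j]. The polynomial function given by the trace
   form and an element [u] of the [w]-th symmetric power of the Lie algebra,
   seen as a tensor, is the extension to [w]-fold tensors of
   X_1 (x) ... (x) X_w |-> (A |-> \prod_r tr (X_r A)). *)
Definition trace_poly (w : nat) (u : tpower (w * 2)) (A : 'M[K]_m) : K :=
  \sum_(i : {ffun 'I_(w * 2) -> 'I_m})
    u i * \prod_(r < w)
      \tr (delta_mx (i (mxtens_index (r, ord0))) (i (mxtens_index (r, ord_max)))
           *m A).

Definition stdform (u v : 'cV[K]_m) : K := (u^T *m v) 0 0.

Definition so_mem (A : 'M[K]_m) : bool := A^T == - A.

End Specialization.

(* Formal power series are the sequences of their coefficients *)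
Section PowerSeries.
Variable T : pzRingType.

Definition ps_mul (f g : nat -> T) : nat -> T :=
  fun n => \sum_(i < n.+1) f i * g (n - i)%N.

Definition ps_one : nat -> T := fun n => (n == 0%N)%:R.

Definition ps_exp (f : nat -> T) (j : nat) : nat -> T :=
  iter j (ps_mul f) ps_one.

(* The inverse of a series [f] with constant coefficient 1: the geometric series
   \sum_j (1 - f) ^ j, in which only the terms with j <= n contribute to the
   n-th coefficient *)
Definition ps_inv (f : nat -> T) : nat -> T :=
  fun n => \sum_(j < n.+1) ps_exp (fun i => ps_one i - f i) j n.

End PowerSeries.

Section BinomialSeries.
Variable K : fieldType.

Definition gbinom (a : K) (j : nat) : K := (\prod_(i < j) (a - i%:R)) / j`!%:R.

(* [f ^ a] for a series [f] with constant coefficient 1: the binomial series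
   \sum_j gbinom a j (f - 1) ^ j, truncated like [ps_inv] *)
Definition ps_pow (a : K) (f : nat -> K) : nat -> K :=
  fun n => \sum_(j < n.+1) gbinom a j * ps_exp (fun i => f i - ps_one K i) j n.

End BinomialSeries.

Section Tsymbaliuk.
Variables (K : fieldType) (m : nat) (A : 'M[K]_m).

(* 1 + tau^2 A^2, with tau the polynomial variable *)
Definition one_plus_sqr : 'M[{poly K}]_m :=
  1%:M + 'X^2 *: map_mx polyC (A *m A).

Definition resolvent : nat -> 'M[K]_m :=
  ps_inv (fun n => map_mx (coefp n) one_plus_sqr).

Definition det_inv_sqrt : nat -> K :=
  ps_pow (- 2%:R^-1) (fun n => (\det one_plus_sqr)`_n).

Definition tsymbaliuk_series (v1 v2 : 'cV[K]_m) : nat -> K :=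
  ps_mul (fun n => stdform v2 (A *m resolvent n *m v1)) det_inv_sqrt.

End Tsymbaliuk.

(* The listed arcs form exactly one diagram *)
Section XArcs.
Local Open Scope nat_scope.

Definition arc_ends (s : seq ((nat + nat) * (nat + nat))) : seq (nat + nat) :=
  flatten [seq [:: a.1; a.2] | a <- s].

Lemma arc_ends_cat s t : arc_ends (s ++ t) = arc_ends s ++ arc_ends t.
Proof. by rewrite /arc_ends map_cat flatten_cat. Qed.

Lemma inner_ends off L :
  arc_ends [seq inner_arc off j | j <- iota 1 L] = map inr (iota off.+1 L.*2).
Proof.
rewrite /arc_ends; elim: L => // L IH; rewrite -[L.+1]addn1 iotaD !map_cat flatten_cat IH.
have ->: (L + 1).*2 = L.*2 + 2 by lia.
rewrite iotaD map_cat /=; congr (_ ++ _).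
by rewrite /inner_arc /=; do 2?[congr cons; first by congr inr; lia].
Qed.

Lemma cycle_ends off l : 0 < l ->
  perm_eq (arc_ends (cycle_arcs off l)) (map inr (iota off l.*2)).
Proof.
case: l => // l _; rewrite /cycle_arcs /= /arc_ends /= -/(arc_ends _) inner_ends.
rewrite perm_cons -[inr off.+1 :: _]/(map (@inr nat nat) (off.+1 :: iota off.+2 l.*2)).
have -> : off.+1 :: iota off.+2 l.*2 = rcons (iota off.+1 l.*2) (off + l.*2.+1).
  by rewrite -cats1 -addSnnS -(iotaD off.+1 l.*2 1) addn1.
by rewrite map_rcons perm_sym perm_rcons.
Qed.

Lemma cycles_ends off nu : all (fun l => 0 < l) nu ->
  perm_eq (arc_ends (cycles_arcs off nu)) (map inr (iota off (sumn nu).*2)).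
Proof.
elim: nu off => // l nu IH off /andP[l0 /IH h].
rewrite -[cycles_arcs _ _]/(cycle_arcs off l ++ cycles_arcs (off + l.*2) nu).
rewrite -[sumn _]/(l + sumn nu) arc_ends_cat doubleD iotaD map_cat.
exact: perm_cat (cycle_ends off l0) (h _).
Qed.

Lemma path_ends M :
  perm_eq (arc_ends (path_arcs M)) (inl 0 :: inl 1 :: map inr (iota 0 M.*2)).
Proof.
rewrite /path_arcs; case: M => // M /=; rewrite /arc_ends /= map_cat flatten_cat.
rewrite -/(arc_ends [seq inner_arc _ _ | _ <- _]) inner_ends /= perm_cons.
have -> : inr 0 :: inr 1 :: [seq inr i | i <- iota 2 M.*2] =
    map (@inr nat nat) (rcons (0 :: iota 1 M.*2) M.*2.+1).
  have -> : rcons (0 :: iota 1 M.*2) M.*2.+1 = iota 0 (M.*2.+1 + 1).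
    by rewrite iotaD cats1.
  by rewrite addn1.
rewrite map_rcons -cats1 perm_sym.
by rewrite -(cat1s (inl 1) (_ ++ _)) perm_catC -catA.
Qed.

Lemma x_ends M nu : all (fun l => 0 < l) nu ->
  perm_eq (arc_ends (x_arcs M nu))
          (inl 0 :: inl 1 :: map inr (iota 0 (M + sumn nu).*2)).
Proof.
move=> nu0; rewrite arc_ends_cat doubleD iotaD map_cat.
exact: (perm_cat (path_ends M) (cycles_ends _ nu0)).
Qed.

Lemma pt_pos_inj k l : injective (@pt_pos k l).
Proof. by case=> i [] j //= [/val_inj->]. Qed.

Lemma arcs_unique k l s :
  perm_eq (arc_ends s) (map (@pt_pos k l) (enum {: 'I_k + 'I_l})) ->
  exists D : arcdiag k l, forall E, has_arcs E s = (E == D).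
Proof.
move=> sP.
have su : uniq (arc_ends s).
  by rewrite (perm_uniq sP) (map_inj_uniq (@pt_pos_inj k l)) enum_uniq.
pose mate (p q : 'I_k + 'I_l) :=
  ((pt_pos p, pt_pos q) \in s) || ((pt_pos q, pt_pos p) \in s).
have mS p q : mate p q = mate q p by rewrite /mate orbC.
have endP x : x \in arc_ends s -> exists p : 'I_k + 'I_l, x = pt_pos p.
  by rewrite (perm_mem sP) => /mapP[p _ ->]; exists p.
have in1 a : a \in s -> (a.1 \in arc_ends s) && (a.2 \in arc_ends s).
  move=> sa; apply/andP; split; apply/flattenP; exists [:: a.1; a.2];
  rewrite ?inE ?eqxx ?orbT //; exact: map_f.
have mE p : exists q, mate p q.
  have : pt_pos p \in arc_ends s by rewrite (perm_mem sP) map_f // mem_enum.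
  case/flattenP => t /mapP[[x y] sa ->]; have /andP[/endP[p1 e1] /endP[p2 e2]] := in1 _ sa.
  move: sa e1 e2 => sa /= e1 e2; subst x y.
  rewrite !inE => /orP[] /eqP/pt_pos_inj->; first by exists p2; rewrite /mate sa.
  by exists p1; rewrite /mate sa orbT.
(* two arcs sharing an end are equal *)
have arc1 a b x : a \in s -> b \in s -> x \in [:: a.1; a.2] -> x \in [:: b.1; b.2] -> a = b.
  elim: s su {sP mate mS endP in1 mE} => //= c s IH.
  rewrite /arc_ends /= -/(arc_ends s) => /and3P[c1 c2 su].
  have sub d y : d \in s -> y \in [:: d.1; d.2] -> y \in arc_ends s.
    by move=> sd yd; apply/flattenP; exists [:: d.1; d.2]; rewrite ?map_f.
  have cn y : y \in [:: c.1; c.2] -> y \notin arc_ends s.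
    rewrite !inE => /orP[] /eqP->; last by [].
    by apply: contra c1; rewrite inE => ->; rewrite orbT.
  rewrite !(in_cons c) => /orP[/eqP->|sa] /orP[/eqP->|sb] // xa xb.
  - by have := cn _ xa; rewrite (sub _ _ sb xb).
  - by have := cn _ xb; rewrite (sub _ _ sa xa).
  - exact: IH.
have arcN a : a \in s -> a.1 != a.2.
  elim: s su {sP mate mS endP in1 mE arc1} => //= c s IH.
  rewrite /arc_ends /= -/(arc_ends s) inE negb_or => /and3P[/andP[c1 _] _ su].
  by rewrite inE => /orP[/eqP->|/IH]; last exact.
have mU p q r : mate p q -> mate p r -> q = r.
  move=> /orP[] h1 /orP[] h2; have := arc1 _ _ (pt_pos p) h1 h2;
    rewrite !inE !eqxx ?orbT => /(_ erefl erefl)[].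
  - by move/pt_pos_inj.
  - by move=> e1 e2; have := arcN _ h1; rewrite /= e2 eqxx.
  - by move=> e1 e2; have := arcN _ h1; rewrite /= e1 eqxx.
  - by move/pt_pos_inj.
have mN p q : mate p q -> q != p.
  by move=> /orP[] /arcN; apply: contra => /eqP->.
pose f p := xchoose (mE p).
have fP p : mate p (f p) by exact: xchooseP.
have fK : involutive f by move=> p; apply: (mU (f p)); rewrite // mS.
have fN p : f p != p by apply: mN.
exists (mk_arcdiag fK fN) => E; apply/allP/eqP => [h|-> a sa].
  apply/val_inj/ffunP => p; rewrite ffunE; apply: (mU p); last exact: fP.
  case/orP: (fP p) => sa; case/existsP: (h _ sa) => /= q /andP[/eqP/pt_pos_inj e1 /eqP/pt_pos_inj e2].
    have -> : val E p = f p by rewrite -e2 e1.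
    exact: fP.
  have -> : val E p = f p by rewrite -e1 -e2; exact: (partnerP E q).1.
  exact: fP.
have /andP[/endP[p ep] /endP[q eq]] := in1 _ sa.
apply/existsP; exists p; rewrite ep eqxx eq ffunE /=; apply/eqP; congr pt_pos.
by apply: (mU p) (fP p) _; rewrite /mate -ep -eq -surjective_pairing sa.
Qed.

Lemma x_arcs_unique w nu : even_partition nu -> sumn nu <= w ->
  exists D : arcdiag 2 (w * 2),
    forall E, has_arcs E (x_arcs (w - sumn nu) nu) = (E == D).
Proof.
move=> /andP[_ nuE] nuw; apply: arcs_unique.
have nu0 : all (fun l => 0 < l) nu by apply: sub_all nuE => l /andP[].
apply: perm_trans (x_ends _ nu0) _; rewrite subnK // -muln2.
apply: uniq_perm.
- rewrite /= !inE /=; apply/and3P; split.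
  + by apply/mapP => -[].
  + by apply/mapP => -[].
  + by rewrite map_inj_uniq ?iota_uniq // => x y [].
- by rewrite (map_inj_uniq (@pt_pos_inj _ _)) enum_uniq.
move=> x; rewrite !inE; apply/or3P/mapP => [[/eqP->|/eqP->|/mapP[j]]|[p _ ->]].
- by exists (inl ord0); rewrite ?mem_enum.
- by exists (inl ord_max); rewrite ?mem_enum.
- by rewrite mem_iota => /andP[_ jw] ->; exists (inr (Ordinal jw)); rewrite ?mem_enum.
- case: p => [[[|[|//]] /=]|j /=]; rewrite ?eqxx; try by constructor.
  by constructor 3; apply: map_f; rewrite mem_iota /= ltn_ord.
Qed.

End XArcs.

(* Construction of [specialization0]: the matrix entries of the image of a
   diagram test whether the two ends of each arc carry the same basis vector.
   Compatibility with composition rests on the fact that a stack of two diagrams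
   has two outer points on each component that is not a loop, which is the
   following lemma on two involutions. *)
Section Dihedral.
Local Open Scope nat_scope.
Variables (T : finType) (a b : T -> T).
Hypotheses (aK : involutive a) (bK : involutive b).
Hypothesis abN : forall x, a x = x -> b x <> x.

Let e : rel T := fun x y => (y == a x) || (y == b x).

Lemma dihedral_end x : a x = x ->
  exists2 y, y != x & forall z, [&& z != x, connect e x z & (a z == z) || (b z == z)] = (z == y).
Proof.
move=> ax; pose f := b \o a.
have finj : injective f by apply: inj_comp; apply: inv_inj.
have ex z : connect e x z = fconnect f x z.
  apply/idP/idP; last first.
    apply: connect_sub => {}z t /eqP <-; apply: (@connect_trans _ _ (a z)); apply: connect1.
      by rewrite /e eqxx.
    by rewrite /e /f /= eqxx orbT.
  case/connectP => p pp ->.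
  have cla z' : fconnect f x z' -> fconnect f x (a z').
    move=> /iter_findex <-; elim: (findex _ _ _) => [|i IH] /=; first by rewrite ax.
    apply: connect_trans IH _; rewrite fconnect_sym //.
    by apply: connect1; rewrite /= /f /= aK bK.
  have gen u : fconnect f x u -> path e u p -> fconnect f x (last u p).
    elim: p u {pp} => [|y p IH] u //= xu /andP[uy pp].
    apply: IH => //; case/orP: uy => /eqP->; first exact: cla.
    apply: connect_trans (cla _ xu) _.
    by apply: connect1; rewrite /= /f /= aK.
  exact: gen.
pose r := fingraph.order f x.
have itinj n : injective (iter n f) by elim: n => [|n IH] //= u v /finj /IH.
have rP : 0 < r by exact: fingraph.order_gt0.
have itr : iter r f x = x by exact: iter_order.
have itE n : 0 < n -> n < r + r -> (iter n f x == x) = (n == r).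
  move=> n0 nr; apply/eqP/eqP => [|->//].
  case: (ltngtP n r) => // h E.
    by have := findex_iter h; rewrite E findex0; lia.
  have h' : n - r < r by lia.
  have := findex_iter h'; have : iter (n - r) f x = x.
    by rewrite -[x in LHS]itr -iterD; have ->: n - r + r = n by lia.
  by move->; rewrite findex0; lia.
have faf z : f (a (f z)) = a z by rewrite /f /= aK bK.
have ita n : iter n f (a (iter n f x)) = x.
  by elim: n => [|n IH] //=; rewrite -iterS iterSr faf.
have afix n : 0 < n -> n < r -> (a (iter n f x) == iter n f x) = (n + n == r).
  move=> n0 nr; rewrite -itE ?iterD; try lia.
  rewrite -(inj_eq (itinj n)) ita eq_sym.
  by [].
have bfix n : 0 < n -> n < r -> (b (iter n f x) == iter n f x) = (n + n == r.+1).
  move=> n0 nr; rewrite -(inj_eq (itinj n)).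
  have ->: b (iter n f x) = f (a (iter n f x)) by rewrite /f /= aK.
  rewrite -iterSr iterS ita -iterD eq_sym.
  have ->: n + n = (n + n).-1.+1 by lia.
  by rewrite iterS (inj_eq finj) itE //; lia.
have r1 : 1 < r.
  rewrite ltn_neqAle rP andbT; apply/eqP => r1.
  apply: (abN ax); move: itr; rewrite -r1 /= /f /= ax.
  by [].
exists (iter (uphalf r) f x).
  apply/eqP => /eqP; rewrite itE; lia.
move=> z; rewrite ex; apply/and3P/eqP => [[zx xz]|->].
  have zr := findex_max xz; rewrite -/r in zr.
  have z0 : 0 < findex f x z.
    by rewrite lt0n; apply: contra zx; rewrite findex_eq0 eq_sym.
  rewrite -(iter_findex xz) afix // bfix //.
  move=> h; congr (iter _ f x); lia.
rewrite fconnect_iter afix ?bfix ?itE; try lia.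
split=> //; lia.
Qed.

End Dihedral.

Section Stack.
Variables (k l n : nat) (D : arcdiag k l) (E : arcdiag l n).
Local Notation pts := (('I_k + 'I_l) + 'I_n)%type.
Local Notation edge := (stack_edge D E).
Local Notation out := (@stack_out k l n).

Let aD (x : pts) : pts := if x is inl p then inl (D p) else x.
Let bE (x : pts) : pts :=
  match x with
  | inl (inl _) => x
  | inl (inr j) => stack_bot k (E (inl j))
  | inr i => stack_bot k (E (inr i))
  end.

Lemma bE_bot q : bE (stack_bot k q) = stack_bot k (E q).
Proof. by case: q. Qed.

Lemma stack_bot_inj : injective (@stack_bot k l n).
Proof. by case=> i [] j //= [->]. Qed.

Lemma aDK : involutive aD.
Proof. by case=> [p|i] //=; rewrite (partnerP D p).1. Qed.

Lemma bEK : involutive bE.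
Proof.
by case=> [[i|j]|i] //=; rewrite bE_bot (partnerP E _).1.
Qed.

Lemma aD_fix x : (aD x == x) = if x is inr _ then true else false.
Proof. case: x => [p|i] /=; rewrite ?eqxx //.
by apply/negbTE; apply: contra_neq (partnerP D p).2 => -[]. Qed.

Lemma bE_fix x : (bE x == x) = if x is inl (inl _) then true else false.
Proof.
have botN q : (stack_bot k (E q) == stack_bot k q) = false.
  by rewrite (inj_eq stack_bot_inj) (negbTE (partnerP E _).2).
by case: x => [[i|j]|i] /=; rewrite ?eqxx //.
Qed.

Lemma edge_sym : symmetric edge.
Proof.
move=> x y; apply/orP/orP => -[] /existsP[p /andP[/eqP-> /eqP->]].
- by left; apply/existsP; exists (D p); rewrite (partnerP D p).1 !eqxx.
- by right; apply/existsP; exists (E p); rewrite (partnerP E p).1 !eqxx.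
- by left; apply/existsP; exists (D p); rewrite (partnerP D p).1 !eqxx.
- by right; apply/existsP; exists (E p); rewrite (partnerP E p).1 !eqxx.
Qed.

Lemma edge_csym : connect_sym edge.
Proof. exact/sym_connect_sym/edge_sym. Qed.

Lemma connect_ab : connect edge =2 connect (fun x y => (y == aD x) || (y == bE x)).
Proof.
move=> x y; apply/idP/idP; apply: connect_sub => {}x {}y.
  case/orP=> /existsP[p /andP[/eqP-> /eqP->]]; apply: connect1.
    by rewrite /= eqxx.
  by rewrite bE_bot eqxx orbT.
case/orP=> /eqP->.
  case: x => [p|i] //=; apply: connect1; apply/orP; left.
  by apply/existsP; exists p; rewrite !eqxx.
case: x => [[i|j]|i] //=; apply: connect1; apply/orP; right; apply/existsP.
  by exists (inl j); rewrite !eqxx.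
by exists (inr i); rewrite !eqxx.
Qed.

Lemma outP x : reflect (exists p, x = out p) ((aD x == x) || (bE x == x)).
Proof.
rewrite aD_fix bE_fix; case: x => [[i|j]|i] /=; constructor.
- by exists (inl i).
- by case=> -[].
- by exists (inr i).
Qed.

Lemma out_inj : injective out.
Proof. by case=> i [] j //= [->]. Qed.

Lemma out_mate p : {q | q != p & forall r, (r != p) && connect edge (out p) (out r) = (r == q)}.
Proof.
suff: exists q, (q != p) && [forall r, (r != p) && connect edge (out p) (out r) == (r == q)].
  by move=> /sigW[q /andP[qp /forallP h]]; exists q => // r; apply/eqP.
have [y yx yP] : exists2 y, y != out p & forall z, [&& z != out p,
  connect (fun x y => (y == aD x) || (y == bE x)) (out p) z & (aD z == z) || (bE z == z)] = (z == y).
  case: p => i /=.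
    have ed : (fun x y => (y == aD x) || (y == bE x)) =2 (fun x y => (y == bE x) || (y == aD x)).
      by move=> x y; rewrite orbC.
    have [|y yx yP] := @dihedral_end _ bE aD bEK aDK _ (inl (inl i)) erefl.
      by move=> x /eqP; rewrite bE_fix => h /eqP; rewrite aD_fix; case: x h.
    by exists y => // z; rewrite -yP (eq_connect ed) (orbC (bE z == z)).
  have [|y yx yP] := @dihedral_end _ aD bE aDK bEK _ (inr i) erefl.
    by move=> x /eqP; rewrite aD_fix => h /eqP; rewrite bE_fix; case: x h.
  by exists y => // z; rewrite -yP.
have /and3P[_ _ /outP[q yq]] : [&& y != out p,
  connect (fun x y => (y == aD x) || (y == bE x)) (out p) y & (aD y == y) || (bE y == y)] by rewrite yP.
exists q; rewrite -(inj_eq out_inj) -yq yx /=; apply/forallP => r.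
rewrite connect_ab -[r == p](inj_eq out_inj) -[r == q](inj_eq out_inj) -yq -yP.
have hr : (aD (out r) == out r) || (bE (out r) == out r) by apply/outP; exists r.
by rewrite hr andbT.
Qed.

Definition mate p := s2val (out_mate p).

Lemma mateP p r : (r != p) && connect edge (out p) (out r) = (r == mate p).
Proof. by rewrite /mate; case: out_mate. Qed.

Lemma mateN p : mate p != p.
Proof. by rewrite /mate; case: out_mate. Qed.

Lemma mate_conn p : connect edge (out p) (out (mate p)).
Proof. by have := mateP p (mate p); rewrite eqxx => /andP[]. Qed.

Lemma mateK : involutive mate.
Proof.
by move=> p; apply/esym/eqP; rewrite -mateP eq_sym mateN edge_csym mate_conn.
Qed.

Definition stacked : arcdiag k n := mk_arcdiag mateK mateN.

Lemma stackedE p : stacked p = mate p.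
Proof. by rewrite ffunE. Qed.

Lemma stack_reducesE G : stack_reduces D E G = (G == stacked).
Proof.
apply/forallP/eqP => [h|-> p]; last by rewrite stackedE mate_conn.
apply/val_inj/ffunP => p; rewrite stackedE; apply/eqP.
by rewrite -mateP (partnerP G p).2 h.
Qed.

Section Count.
Variable m : nat.

Definition pt_col a b (i : {ffun 'I_a -> 'I_m}) (j : {ffun 'I_b -> 'I_m}) (p : 'I_a + 'I_b) :=
  match p with inl a => i a | inr b => j b end.

Definition agree a b (G : arcdiag a b) i j := [forall p, pt_col i j (G p) == pt_col i j p].

Variables (i : {ffun 'I_k -> 'I_m}) (h : {ffun 'I_n -> 'I_m}).

Definition col3 (j : {ffun 'I_l -> 'I_m}) (x : pts) :=
  match x with inl p => pt_col i j p | inr c => h c end.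

Lemma agree2P j : reflect (forall x y, connect edge x y -> col3 j x = col3 j y)
   (agree D i j && agree E j h).
Proof.
apply: (iffP andP) => [[/forallP dP /forallP eP]|hh].
  have h1 x y : edge x y -> col3 j x = col3 j y.
    case/orP=> /existsP[p /andP[/eqP-> /eqP->]] /=.
      by rewrite (eqP (dP p)).
    have c3 q : col3 j (stack_bot k q) = pt_col j h q by case: q.
    by rewrite !c3 (eqP (eP p)).
  move=> x y /connectP[p pp ->]; elim: p x pp => //= z p IH x /andP[xz /IH <-].
  exact: h1.
split; apply/forallP => p; apply/eqP.
  apply: (hh (inl (D p)) (inl p)); apply: connect1.
  by apply/orP; left; apply/existsP; exists (D p); rewrite (partnerP D p).1 !eqxx.
have c3 q : col3 j (stack_bot k q) = pt_col j h q by case: q.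
rewrite -!c3; apply: hh; apply: connect1.
by apply/orP; right; apply/existsP; exists (E p); rewrite (partnerP E p).1 !eqxx.
Qed.

Lemma col3_out j p : col3 j (out p) = pt_col i h p.
Proof. by case: p. Qed.

Let loop x := [forall p, ~~ connect edge x (out p)].

Lemma loop_connect x y : connect edge x y -> loop x = loop y.
Proof.
by move=> xy; apply: eq_forallb => p; rewrite (same_connect edge_csym xy).
Qed.

Definition loop_roots : {set pts} := [set x | (x \in roots edge) && loop x].

Lemma card_loop_roots : #|loop_roots| = stack_loops D E.
Proof. by rewrite /stack_loops /n_comp_mem; apply: eq_card => x; rewrite !inE. Qed.

Lemma loop_mid x : loop x -> {b : 'I_l | x = inl (inr b)}.
Proof.
case: x => [[a|b]|c] /forallP hx; last 1 first.
- by have := hx (inr c); rewrite connect0.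
- by have := hx (inl a); rewrite connect0.
- by exists b.
Qed.

Lemma count_col :
  #|[set j | agree D i j && agree E j h]| = (agree stacked i h * m ^ stack_loops D E)%N.
Proof.
case: (boolP (agree stacked i h)) => [/forallP ag|nag]; last first.
  rewrite mul0n; apply/eqP; rewrite cards_eq0; apply/eqP/setP => j; rewrite !inE.
  apply/negbTE; apply: contra nag => /agree2P jP; apply/forallP => p.
  by rewrite -!(col3_out j) eq_sym (jP _ _ (mate_conn p)) stackedE.
rewrite mul1n -card_loop_roots.
have agc p q : connect edge (out p) (out q) -> pt_col i h p = pt_col i h q.
  move=> pq; case: (eqVneq q p) => [->//|qp].
  have /eqP-> : q == mate p by rewrite -mateP qp.
  by rewrite -stackedE (eqP (ag p)).
pose V := [set j | agree D i j && agree E j h].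
pose X := {x : pts | x \in loop_roots}.
pose f (j : {ffun 'I_l -> 'I_m}) : {ffun X -> 'I_m} := [ffun x => col3 j (val x)].
have -> : #|V| = #|f @: V|.
  apply/esym/card_in_imset => j1 j2; rewrite !inE => /agree2P h1 /agree2P h2 fE.
  apply/ffunP => b; pose x : pts := inl (inr b).
  have -> : j1 b = col3 j1 x by []. have -> : j2 b = col3 j2 x by [].
  case: (boolP (loop x)) => [lx|/forallPn[p /negPn px]]; last first.
    by rewrite (h1 _ _ px) (h2 _ _ px) !col3_out.
  have rx := connect_root edge x; rewrite (h1 _ _ rx) (h2 _ _ rx).
  have rl : fingraph.root edge x \in loop_roots.
    by rewrite inE -(loop_connect rx) lx ?unfold_in /= (root_root edge_csym) eqxx.
  by have /ffunP/(_ (exist (fun x => x \in loop_roots) _ rl)) := fE; rewrite !ffunE.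
have -> : f @: V = setT.
  apply/setP => phi; rewrite !inE; apply/imsetP.
  pose g x := match [pick p | connect edge x (out p)] with
    | Some p => Some (pt_col i h p)
    | None => omap phi (insub (fingraph.root edge x)) end.
  have gl x : loop x -> g x = omap phi (insub (fingraph.root edge x)).
    by rewrite /g; case: pickP => // p px /forallP/(_ p); rewrite px.
  have go p x : connect edge x (out p) -> g x = Some (pt_col i h p).
    rewrite /g; case: pickP => [q xq xp|/(_ p)->] //; congr Some; apply: agc.
    by apply: connect_trans xp; rewrite edge_csym.
  have gc x y : connect edge x y -> g x = g y.
    move=> xy; case: (boolP (loop x)) => [lx|/forallPn[p /negPn px]].
      rewrite gl // gl -?(loop_connect xy) //.
      by rewrite (fingraph.rootP edge_csym xy).
    by rewrite !(go p) //; apply: connect_trans px; rewrite edge_csym.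
  have gS x : {c | g x = Some c}.
    case: (boolP (loop x)) => [lx|].
      rewrite gl //; case: insubP => [u _ _|]; first by exists (phi u).
      by rewrite inE unfold_in /= (root_root edge_csym) eqxx -(loop_connect (connect_root edge x)) lx.
    by rewrite negb_forall => /existsP/sigW[p /negPn px]; exists (pt_col i h p); rewrite (go p).
  pose j : {ffun 'I_l -> 'I_m} := [ffun b => sval (gS (inl (inr b)))].
  have jg x : Some (col3 j x) = g x.
    case: x => [[a|b]|c] /=.
    - by rewrite (go (inl a)) ?connect0.
    - by rewrite ffunE; case: (gS _).
    - by rewrite (go (inr c)) ?connect0.
  exists j.
    by rewrite inE; apply/agree2P => x y /gc; rewrite -!jg => -[].
  apply/ffunP => -[x xl]; rewrite ffunE /=.
  have := xl; rewrite inE => /andP[xr lx].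
  have := jg x; rewrite gl // (eqP xr) insubT /= => -[->]; congr (phi _).
by rewrite cardsT card_ffun card_ord card_sig; congr (_ ^ _)%N; apply: eq_card.
Qed.

End Count.
End Stack.

Section Functor.
Variables (K : fieldType) (m : nat).
Local Notation idx k := {ffun 'I_k -> 'I_m}.

Definition kc k l (f : bhom K k l) (i : idx k) (j : idx l) : K :=
  \sum_D f D * (agree D i j)%:R.

Lemma kcP k l i j (c : K) (f g : bhom K k l) :
  kc (c *: f + g) i j = c * kc f i j + kc g i j.
Proof.
rewrite /kc mulr_sumr -big_split /=; apply: eq_bigr => D _.
by rewrite !ffunE mulrDl mulrA.
Qed.

Lemma kc0 k l i j : kc (0 : bhom K k l) i j = 0.
Proof. by rewrite /kc big1 // => D _; rewrite ffunE mul0r. Qed.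

Lemma kcZ k l i j c (f : bhom K k l) : kc (c *: f) i j = c * kc f i j.
Proof. by rewrite -[c *: f]addr0 kcP kc0 addr0. Qed.

Lemma kc_sum k l (I : finType) (P : pred I) (f : I -> bhom K k l) i j :
  kc (\sum_(s | P s) f s) i j = \sum_(s | P s) kc (f s) i j.
Proof.
apply: (big_morph (fun f : bhom K k l => kc f i j)) => [f1 f2|]; last exact: kc0.
by rewrite -[f1]scale1r kcP scale1r mul1r.
Qed.

Lemma kc_sumZ k l (I : finType) (P : pred I) (a : I -> K) (f : I -> bhom K k l) i j :
  kc (\sum_(s | P s) a s *: f s) i j = \sum_(s | P s) a s * kc (f s) i j.
Proof. by rewrite kc_sum; apply: eq_bigr => s _; rewrite kcZ. Qed.

Lemma kc_diag k l (D : arcdiag k l) i j : kc (bdiag K D) i j = (agree D i j)%:R.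
Proof.
rewrite /kc (bigD1 D) //= big1 ?addr0 => [|E /negbTE ED]; rewrite ffunE ?eqxx ?mul1r //.
by rewrite ED mul0r.
Qed.

Lemma agree_perm k (s : 'S_k) (i j : idx k) :
  agree (perm_diag s) i j = (i == [ffun a => j (s a)]).
Proof.
apply/forallP/eqP => [h|-> p].
  apply/ffunP => a; rewrite ffunE; have /eqP := h (inl a).
  by rewrite ffunE.
by case: p => a; rewrite !ffunE /= ?ffunE ?permKV.
Qed.

Lemma kc_id k (i j : idx k) : kc (bid K k) i j = (i == j)%:R.
Proof.
rewrite kc_diag agree_perm; congr (_ == _)%:R.
by apply/ffunP => a; rewrite ffunE perm1.
Qed.

Lemma kc_stack k l n (E : arcdiag l n) (D : arcdiag k l) i h :
  kc (stack_diag m%:R E D) i h =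
  \sum_j (agree D i j)%:R * (agree E j h)%:R.
Proof.
rewrite /stack_diag (eq_bigl (pred1 (stacked D E))) => [|G]; last exact: stack_reducesE.
rewrite big_pred1_eq kcZ kc_diag.
under eq_bigr do rewrite -natrM mulnb.
rewrite -natr_sum -natrX -natrM mulnC -count_col -sum1_card big_mkcond /=.
by congr _%:R; apply: eq_bigr => j _; rewrite inE; case: ifP.
Qed.

Lemma kc_comp k l n (g : bhom K l n) (f : bhom K k l) i h :
  kc (bcomp m%:R g f) i h = \sum_j kc f i j * kc g j h.
Proof.
rewrite /bcomp kc_sum.
under eq_bigr do rewrite kc_sumZ.
under [RHS]eq_bigr => j _ do rewrite /kc big_distrlr /=.
rewrite [RHS]exchange_big /=; apply: eq_bigr => D _.
rewrite [RHS]exchange_big /=; apply: eq_bigr => E _.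
rewrite kc_stack mulr_sumr; apply: eq_bigr => j _.
by rewrite mulrACA.
Qed.

Definition lidx k l (i : idx (k + l)) : idx k := [ffun a => i (lshift l a)].
Definition ridx k l (i : idx (k + l)) : idx l := [ffun a => i (rshift k a)].
Definition jidx k l (i : idx k * idx l) : idx (k + l) :=
  [ffun x => match split x with inl a => i.1 a | inr b => i.2 b end].

Lemma jidx_bij k l : bijective (@jidx k l).
Proof.
exists (fun i => (lidx i, ridx i)) => [[i1 i2]|i].
  congr pair; apply/ffunP => a; rewrite !ffunE.
    by rewrite (unsplitK (inl a)).
  by rewrite (unsplitK (inr a)).
apply/ffunP => x; rewrite ffunE -[in RHS](splitK x).
by case: split => a; rewrite ffunE.
Qed.

Lemma agree_juxt k1 l1 k2 l2 (D : arcdiag k1 l1) (E : arcdiag k2 l2) i j :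
  agree (juxt_diag D E) i j =
  agree D (lidx i) (lidx j) && agree E (ridx i) (ridx j).
Proof.
have c1 p : pt_col i j (juxt (inl p)) = pt_col (lidx i) (lidx j) p :> 'I_m.
  by case: p => a /=; rewrite ffunE.
have c2 p : pt_col i j (juxt (inr p)) = pt_col (ridx i) (ridx j) p :> 'I_m.
  by case: p => a /=; rewrite ffunE.
apply/forallP/andP => [h|[/forallP h1 /forallP h2] p].
  split; apply/forallP => p.
    by have := h (juxt (inl p)); rewrite ffunE /juxt_pt juxtK !c1.
  by have := h (juxt (inr p)); rewrite ffunE /juxt_pt juxtK !c2.
rewrite ffunE /juxt_pt -[in X in _ == X](unjuxtK p).
by case: (unjuxt p) => q; rewrite ?c1 ?c2.
Qed.

Lemma kc_tens k1 l1 k2 l2 (f : bhom K k1 l1) (g : bhom K k2 l2) i j :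
  kc (btens f g) i j = kc f (lidx i) (lidx j) * kc g (ridx i) (ridx j).
Proof.
rewrite /btens kc_sum.
under eq_bigr do rewrite kc_sumZ.
rewrite /kc big_distrlr /=; apply: eq_bigr => D _; apply: eq_bigr => E _.
rewrite -/(kc _ _ _) kc_diag agree_juxt -mulnb natrM.
by rewrite mulrACA.
Qed.

Definition spec_act k l (f : bhom K k l) (u : tpower K m k) : tpower K m l :=
  [ffun j => \sum_i kc f i j * u i].

Lemma spec_act_linear k l f : linear (@spec_act k l f).
Proof.
move=> a u v; apply/ffunP => j; rewrite !ffunE /GRing.scale /= mulr_sumr -big_split /=.
by apply: eq_bigr => i _; rewrite !ffunE /GRing.scale /= mulrDr mulrCA.
Qed.

HB.instance Definition _ k l f :=
  GRing.isLinear.Build K (tpower K m k) (tpower K m l) _ (@spec_act k l f) (@spec_act_linear k l f).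

Definition spec0 k l (f : bhom K k l) : 'Hom(tpower K m k, tpower K m l) :=
  linfun (spec_act f).

Lemma spec0E k l (f : bhom K k l) u j : spec0 f u j = \sum_i kc f i j * u i.
Proof. by rewrite lfunE ffunE. Qed.

Lemma spec0_linear k l : linear (@spec0 k l).
Proof.
move=> a f g; apply/lfunP => u; rewrite add_lfunE scale_lfunE.
apply/ffunP => j; rewrite !ffunE /GRing.scale /= !spec0E mulr_sumr -big_split /=.
apply: eq_bigr => i _; rewrite kcP.
by rewrite mulrDl mulrA.
Qed.

HB.instance Definition _ k l :=
  GRing.isLinear.Build K (bhom K k l) 'Hom(tpower K m k, tpower K m l) _ (@spec0 k l) (@spec0_linear k l).

Lemma eL (a : 'I_1) : lshift 1 a = ord0 :> 'I_2.
Proof. by rewrite ord1; apply: val_inj. Qed.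

Lemma eR (a : 'I_1) : rshift 1 a = ord_max :> 'I_2.
Proof. by rewrite ord1; apply: val_inj. Qed.

Lemma tbase2E i j (x : idx 2) :
  tmul2 (tbase K i) (tbase K j) x = (x ord0 == i)%:R * (x ord_max == j)%:R.
Proof.
rewrite /tmul2 /tmul ffunE !ffunE !mxE eqxx !andbT.
by rewrite (eL ord0) (eR ord0).
Qed.

Lemma spec0_id k : spec0 (bid K k) = \1%VF.
Proof.
apply/lfunP => u; rewrite id_lfunE; apply/ffunP => j.
rewrite spec0E (bigD1 j) //= kc_id eqxx mul1r big1 ?addr0 // => i /negbTE ij.
by rewrite kc_id ij mul0r.
Qed.

Lemma spec0_comp k l n (g : bhom K l n) (f : bhom K k l) :
  spec0 (bcomp m%:R g f) = (spec0 g \o spec0 f)%VF.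
Proof.
apply/lfunP => u; rewrite comp_lfunE; apply/ffunP => h; rewrite spec0E [RHS]spec0E.
under eq_bigr do rewrite kc_comp mulr_suml.
rewrite exchange_big /=; apply: eq_bigr => j _; rewrite spec0E mulr_sumr.
by apply: eq_bigr => i _; rewrite mulrCA mulrA.
Qed.

Lemma spec0_tens k1 l1 k2 l2 (f : bhom K k1 l1) (g : bhom K k2 l2)
    (u : tpower K m k1) (v : tpower K m k2) :
  spec0 (btens f g) (tmul u v) = tmul (spec0 f u) (spec0 g v).
Proof.
apply/ffunP => j; rewrite ffunE !spec0E big_distrlr /=.
rewrite pair_big /= (reindex _ (onW_bij _ (jidx_bij k1 k2))) /=.
apply: eq_bigr => -[i1 i2] _; rewrite kc_tens ffunE /=.
have E1 : lidx (jidx (i1, i2)) = i1.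
  by apply/ffunP => a; rewrite !ffunE (unsplitK (inl a)).
have E2 : ridx (jidx (i1, i2)) = i2.
  by apply/ffunP => a; rewrite !ffunE (unsplitK (inr a)).
rewrite -/(lidx _) -/(ridx _) E1 E2.
by rewrite mulrACA.
Qed.

Lemma spec0_cross (u v : tpower K m 1) :
  spec0 (bcross K) (tmul2 u v) = tmul2 v u.
Proof.
apply/ffunP => j; rewrite spec0E.
pose i0 : idx 2 := [ffun a => j (tperm ord0 ord_max a)].
rewrite (bigD1 i0) //= big1 ?addr0 => [|i /negbTE ij]; last first.
  by rewrite kc_diag agree_perm ij mul0r.
rewrite kc_diag agree_perm eqxx mul1r !ffunE mulrC.
have jt a b : tperm ord0 ord_max a = b -> i0 a = j b by move=> <-; rewrite ffunE.
congr (v _ * u _); apply/ffunP => a; rewrite [RHS]ffunE [LHS]ffunE; apply: jt.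
  by rewrite eR eL tpermR.
by rewrite eL eR tpermL.
Qed.

Lemma spec0_cup i j :
  spec0 (bcup K) (tmul2 (tbase K i) (tbase K j)) = (i == j)%:R *: tone K m.
Proof.
apply/ffunP => h; rewrite spec0E !ffunE.
pose i0 : idx 2 := [ffun a => if a == ord0 then i else j].
rewrite (bigD1 i0) //= big1 ?addr0 => [|x xi]; last first.
  rewrite tbase2E; case: eqP => [x0|]; last by rewrite mul0r mulr0.
  case: eqP => [x1|]; last by rewrite !mulr0.
  case/eqP: xi; apply/ffunP => a; rewrite ffunE -x0 -x1.
  case: eqP => [->//|/eqP a0]; congr (x _); apply: val_inj => /=.
  by case: a a0 => -[|[|]].
rewrite tbase2E !ffunE !eqxx mulr1 mulr1 kc_diag /GRing.scale /= mulr1.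
congr (nat_of_bool _)%:R; apply/forallP/eqP => [/(_ (inl ord0))|ij].
  by rewrite ffunE /= !ffunE /= => /eqP.
by case=> [a|[]] //; rewrite ffunE /= !ffunE /= ij !if_same.
Qed.

Lemma spec0_cap :
  spec0 (bcap K) (tone K m) = \sum_(i < m) tmul2 (tbase K i) (tbase K i).
Proof.
apply/ffunP => h; rewrite spec0E sum_ffunE.
rewrite (bigD1 [ffun a : 'I_0 => h ord0]) //= big1 ?addr0 => [|x /eqP[]]; last first.
  by apply/ffunP => -[].
rewrite ffunE mulr1 kc_diag.
under eq_bigr => a _ do rewrite tbase2E.
rewrite (bigD1 (h ord0)) //= eqxx mul1r big1 ?addr0 => [|a /negbTE ha]; last first.
  by rewrite eq_sym ha mul0r.
congr (nat_of_bool _)%:R; apply/forallP/eqP => [/(_ (inr ord0))|ij].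
  by rewrite ffunE /= => /eqP <-; congr (h _); apply: val_inj.
case=> [[]|a] //; rewrite ffunE /=.
have h1 b : h b = h ord0.
  by case: b => -[|[|//]] q; last rewrite -ij; congr (h _); apply: val_inj.
by rewrite !h1.
Qed.

Definition spec_lin k l :
  {linear bhom K k l -> 'Hom(tpower K m k, tpower K m l)} := @spec0 k l.

Definition specialization0 : specialization K m :=
  @Specialization K m spec_lin spec0_id spec0_comp spec0_tens spec0_cross
    spec0_cup spec0_cap.

End Functor.

(* Main.v *)
Require Import Defs.
From mathcomp Require Import all_boot all_order all_algebra all_fingroup.
From mathcomp Require Import reals complex mxtens zify ring.

Set Implicit Arguments.
Unset Strict Implicit.
Unset Printing Implicit Defensive.

Import GRing.Theory Num.Theory.
Local Open Scope ring_scope.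

(* A specialization is determined by its values on identities, crossing, cup and
   cap, because every diagram is built from these by stacking and juxtaposition;
   so it may be computed in coordinates. For skew [A], the symmetrizer [s_w]
   only contributes the factor [w! 2^w] to a trace polynomial, the path of
   [x_{M, nu}] evaluates to [(v2, A^M v1)], and each of its cycles of length [l]
   to [tr (A^l)]. The kappa coefficients are those of an exponential: summing over
   partitions with weights [1 / (prod nu_i * prod m_nu(l)!)] gives the Taylor
   coefficients of [exp (sum_l tr (A^l) tau^l / l)], [l] even. Substituting
   [-A^2] for [A^2], this is [det (1 + tau^2 A^2) ^ (-1/2)], since by Jacobi's
   formula both series solve the same first order linear equation. *)

(** * Generation of the Brauer category *)

Section DiagramCalculus.

Local Notation idx m k := {ffun 'I_k -> 'I_m}.

Lemma agreeP m k l (D : arcdiag k l) (i : idx m k) (j : idx m l) :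
  reflect (forall p, pt_col i j (D p) = pt_col i j p) (agree D i j).
Proof. by apply: (iffP forallP) => h p; apply/eqP/h. Qed.

Lemma eq_arcdiag k l (D E : arcdiag k l) : D =1 E -> D = E.
Proof. by move=> DE; apply/val_inj/ffunP. Qed.

(* Colouring one arc of [G] differently from all other points detects that arc
   in the stacked diagram, and a loop would double the number of colourings. *)
Lemma stack_diag_two_colours k l n (D : arcdiag k l) (E : arcdiag l n)
    (G : arcdiag k n) :
    (forall (i : idx 2 k) (h : idx 2 n),
      #|[set j | agree D i j && agree E j h]| = agree G i h) ->
  forall (K : fieldType) (t : K), stack_diag t E D = bdiag K G.
Proof.
move=> cnt K t; pose col (x : pred ('I_k + 'I_n)) q : 'I_2 := if q \in x then ord_max else ord0.
have colE x q : pt_col [ffun a => col x (inl a)] [ffun b => col x (inr b)] q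
    = col x q by case: q => a; rewrite /= ffunE.
have cntE x := cnt [ffun a => col x (inl a)] [ffun b => col x (inr b)].
have loops0 : stack_loops D E = 0%N.
  have := cntE pred0; rewrite count_col.
  have all0 H : agree H [ffun a => col pred0 (inl a)] [ffun b => col pred0 (inr b)].
    by apply/agreeP => p; rewrite !colE.
  by rewrite !all0 mul1n; case: (stack_loops _ _) => // L; rewrite expnS; lia.
have stG : stacked D E = G.
  apply: eq_arcdiag => p; have := cntE (pred2 p (G p)); rewrite count_col.
  have -> : agree G [ffun a => col (pred2 p (G p)) (inl a)]
                    [ffun b => col (pred2 p (G p)) (inr b)].
    apply/agreeP => q; rewrite !colE /col !inE orbC; congr (if _ then _ else _).
    have inj : injective G.
      by move=> u v uv; rewrite -[u](partnerP G u).1 uv (partnerP G v).1.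
    by rewrite (inj_eq inj) -[X in G q == X](partnerP G p).1 (inj_eq inj).
  case: agreeP => // /(_ p); rewrite !colE /col !inE eqxx /=.
  by rewrite (negbTE (partnerP (stacked D E) p).2) /=; case: eqP.
rewrite /stack_diag (eq_bigl (pred1 (stacked D E))) => [|H]; last exact: stack_reducesE.
by rewrite big_pred1_eq loops0 expr0 scale1r stG.
Qed.

Lemma sum_bdiag (K : fieldType) k l (f : bhom K k l) :
  f = \sum_D f D *: bdiag K D.
Proof.
apply/ffunP => G; rewrite sum_ffunE (bigD1 G) //= big1 ?addr0 => [|D /negbTE DG].
  by rewrite !ffunE eqxx /GRing.scale /= mulr1.
by rewrite !ffunE eq_sym DG /GRing.scale /= mulr0.
Qed.

Lemma sum_bdiagE (K : fieldType) k l (V : lmodType K) (D : arcdiag k l)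
    (g : arcdiag k l -> V) : \sum_E bdiag K D E *: g E = g D.
Proof.
rewrite (bigD1 D) //= big1 ?addr0 => [|E /negbTE ED]; rewrite ffunE ?eqxx ?scale1r //.
by rewrite ED scale0r.
Qed.

Lemma bcomp_bdiag (K : fieldType) (t : K) k l n (E : arcdiag l n) (D : arcdiag k l) :
  bcomp t (bdiag K E) (bdiag K D) = stack_diag t E D.
Proof.
rewrite /bcomp; under eq_bigr do under eq_bigr do rewrite -scalerA.
under eq_bigr do rewrite -scaler_sumr sum_bdiagE.
by rewrite sum_bdiagE.
Qed.

Lemma btens_bdiag (K : fieldType) k1 l1 k2 l2 (D : arcdiag k1 l1) (E : arcdiag k2 l2) :
  btens (bdiag K D) (bdiag K E) = bdiag K (juxt_diag D E).
Proof.
rewrite /btens; under eq_bigr do under eq_bigr do rewrite -scalerA.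
under eq_bigr do rewrite -scaler_sumr sum_bdiagE.
by rewrite sum_bdiagE.
Qed.

(** The colouring of the middle row is forced by that of the bottom row, so there is one compatible
    colouring or none, and no loop arises. *)
Lemma perm_diagM (K : fieldType) (t : K) n (s u : 'S_n) :
  bcomp t (bdiag K (perm_diag u)) (bdiag K (perm_diag s)) =
  bdiag K (perm_diag (s * u)%g).
Proof.
rewrite bcomp_bdiag; apply: stack_diag_two_colours => i h.
have -> : [set j | agree (perm_diag s) i j && agree (perm_diag u) j h] =
    if agree (perm_diag (s * u)%g) i h then [set [ffun a => h (u a)]] else set0.
  apply/setP => j; rewrite !inE !agree_perm.
  have -> : [ffun a => h ((s * u)%g a)] = [ffun a => [ffun b => h (u b)] (s a)].
    by apply/ffunP => a; rewrite !ffunE permM.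
  case: (eqVneq j [ffun a => h (u a)]) => [->|/negbTE ju]; rewrite ?andbT ?andbF.
    by case: ifP; rewrite inE ?eqxx.
  by case: ifP; rewrite inE ?ju.
by case: ifP; rewrite ?cards1 ?cards0.
Qed.

(* [phi] names the points off the arc of [x], and [D'] is [D] without that arc *)
Lemma restrict_diag k l k' l' (D : arcdiag k l) x
    (phi : 'I_k' + 'I_l' -> 'I_k + 'I_l) : injective phi ->
    (forall p, (p \notin codom phi) = (p == x) || (p == D x)) ->
  exists D' : arcdiag k' l',
    forall m (i : idx m k) (h : idx m l) (i' : idx m k') (h' : idx m l'),
      (forall q, pt_col i' h' q = pt_col i h (phi q)) ->
    agree D i h = (pt_col i h x == pt_col i h (D x)) && agree D' i' h'.
Proof.
move=> phiI cod; have DK p := (partnerP D p).1.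
have Dphi q : D (phi q) \in codom phi.
  apply: contraT; rewrite cod => Dq.
  have : phi q \notin codom phi.
    by rewrite cod; case/orP: Dq => /eqP e; rewrite -[phi q]DK e ?DK eqxx ?orbT.
  by rewrite codom_f.
pose f q := iinv (Dphi q).
have fE q : phi (f q) = D (phi q) by rewrite f_iinv.
have fK : involutive f by move=> q; apply: phiI; rewrite !fE DK.
have fN q : f q != q.
  by apply: contraTneq (partnerP D (phi q)).2 => fq; rewrite -fE fq eqxx.
exists (mk_arcdiag fK fN) => m i h i' h' col.
apply/agreeP/andP => [ag|[/eqP colx /agreeP ag] p].
  split; first by rewrite ag.
  by apply/agreeP => q; rewrite ffunE !col fE ag.
case: (boolP (p \in codom phi)) => [/codomP[q ->]|].
  by rewrite -fE -!col; have := ag q; rewrite ffunE.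
by rewrite cod => /orP[] /eqP->; rewrite ?DK.
Qed.

(** Serves to bring the two ends of an arc to the first two positions, where a cup or a cap can be
    juxtaposed. *)
Lemma ex_perm2 n (a b : 'I_n.+2) : a != b ->
  exists s : 'S_n.+2, s ord0 = a /\ s (lift ord0 ord0) = b.
Proof.
move=> ab; pose u := tperm ord0 a; pose c := u b.
have uc : u c = b by rewrite /c /u tpermK.
have c0 : c != ord0.
  by apply: contra_neq ab => c0; rewrite -uc c0 /u tpermL.
exists (tperm (lift ord0 ord0) c * u)%g; split; rewrite permM.
  by rewrite [tperm _ c _]tpermD // /u tpermL.
by rewrite [tperm _ c _]tpermL.
Qed.

Lemma ord2P n (c : 'I_n.+2) :
  [\/ c = ord0, c = lift ord0 ord0 | exists d : 'I_n, c = rshift 2 d].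
Proof.
case: c => -[|[|c]] ic; [constructor 1|constructor 2|constructor 3]; try exact: val_inj.
by exists (Ordinal (ic : (c < n)%N)); apply: val_inj.
Qed.

Lemma rshift0 k (a : 'I_k) : rshift 0 a = a.
Proof. exact: val_inj. Qed.

Lemma agree_cap m (i : idx m 0) (j : idx m 2) :
  agree cap_diag i j = (j ord0 == j (lift ord0 ord0)).
Proof.
apply/agreeP/eqP => [/(_ (inr (lift ord0 ord0)))|j01 [[]//|b]].
  by rewrite ffunE /= => <-; congr (j _); apply: val_inj.
rewrite ffunE /=; case: (@ord2P 0 b) => [->|->|[[]//]].
  by rewrite j01; congr (j _); apply: val_inj.
by rewrite -j01; congr (j _); apply: val_inj.
Qed.

Lemma agree_cup m (i : idx m 2) (j : idx m 0) :
  agree cup_diag i j = (i ord0 == i (lift ord0 ord0)).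
Proof.
apply/agreeP/eqP => [/(_ (inl (lift ord0 ord0)))|j01 [b|[]//]].
  by rewrite ffunE /= => <-; congr (i _); apply: val_inj.
rewrite ffunE /=; case: (@ord2P 0 b) => [->|->|[[]//]].
  by rewrite j01; congr (i _); apply: val_inj.
by rewrite -j01; congr (i _); apply: val_inj.
Qed.

(** The permutation [s] carries the two ends of the cap to [a] and [b], and the other arcs of [D]
    form [D']. No loop arises, so the factorization holds for every parameter [t]. *)
Lemma peel_cap k l (D : arcdiag k l.+2) a b : D (inr a) = inr b ->
  exists (s : 'S_l.+2) (D' : arcdiag k l), forall (K : fieldType) (t : K),
    bdiag K D = bcomp t (bdiag K (perm_diag s)) (btens (bcap K) (bdiag K D')).
Proof.
move=> Dab; have ab : a != b.
  by apply: contraTneq (partnerP D (inr a)).2 => ab; rewrite negbK Dab ab.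
have [s [s0 s1]] := ex_perm2 ab.
pose phi (q : 'I_k + 'I_l) : 'I_k + 'I_l.+2 :=
  match q with inl c => inl c | inr d => inr (s (rshift 2 d)) end.
have phiI : injective phi.
  by move=> [c|d] [c'|d'] //= [h]; rewrite ?h // (@rshift_inj 2 _ _ _ (perm_inj h)).
have cod p : (p \notin codom phi) = (p == inr a) || (p == D (inr a)).
  rewrite Dab -s0 -s1; case: p => [c|d].
    by rewrite -[inl c]/(phi (inl c)) codom_f.
  rewrite -[d](permKV s); move: (s^-1 d)%g => {}d.
  have shape (q : 'I_k + 'I_l) e : inr (s e) = phi q -> exists d', e = rshift 2 d'.
    by case: q => [//|d'] [/perm_inj->]; exists d'.
  rewrite ![inr _ == inr _](inj_eq inr_inj) !(inj_eq perm_inj).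
  case: (ord2P d) => [->|->|[d' ->]]; rewrite ?eqxx ?orbT.
  - by apply/negP => /codomP[q /shape[d']].
  - by apply/negP => /codomP[q /shape[d']].
  - by rewrite -[inr _]/(phi (inr d')) codom_f.
have [D' D'P] := restrict_diag phiI cod.
exists s, D' => K t; rewrite btens_bdiag bcomp_bdiag.
apply/esym; apply: stack_diag_two_colours => i h.
(* The only middle colouring compatible with [h] below [s]. *)
pose j0 : idx 2 (2 + l) := [ffun c => h (s c)].
have -> : agree D i h = agree (juxt_diag cap_diag D') i j0.
  rewrite agree_juxt agree_cap.
  rewrite (D'P _ i h (@ridx _ 0 k i) (@ridx _ 2 l j0)); last first.
    by case=> c; rewrite /= !ffunE ?rshift0.
  rewrite Dab /= -s0 -s1 !ffunE.
  by congr ((h (s _) == h (s _)) && _); apply: val_inj.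
have -> : [set j | agree (juxt_diag cap_diag D') i j && agree (perm_diag s) j h] =
    if agree (juxt_diag cap_diag D') i j0 then [set j0] else set0.
  apply/setP => j; rewrite !inE agree_perm.
  case: (eqVneq j j0) => [->|/negbTE jj]; rewrite ?andbT ?andbF.
    by case: ifP; rewrite inE ?eqxx.
  by case: ifP; rewrite inE ?jj.
by case: ifP; rewrite ?cards1 ?cards0.
Qed.

(** Mirror image of [peel_cap]. The permutation is now read from the top row to the middle row,
    hence the inverse of the [s] that places the ends. *)
Lemma peel_cup k l (D : arcdiag k.+2 l) a b : D (inl a) = inl b ->
  exists (s : 'S_k.+2) (D' : arcdiag k l), forall (K : fieldType) (t : K),
    bdiag K D = bcomp t (btens (bcup K) (bdiag K D')) (bdiag K (perm_diag s)).
Proof.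
move=> Dab; have ab : a != b.
  by apply: contraTneq (partnerP D (inl a)).2 => ab; rewrite negbK Dab ab.
have [s [s0 s1]] := ex_perm2 ab.
pose phi (q : 'I_k + 'I_l) : 'I_k.+2 + 'I_l :=
  match q with inr c => inr c | inl d => inl (s (rshift 2 d)) end.
have phiI : injective phi.
  by move=> [c|d] [c'|d'] //= [h]; rewrite ?h // (@rshift_inj 2 _ _ _ (perm_inj h)).
have cod p : (p \notin codom phi) = (p == inl a) || (p == D (inl a)).
  rewrite Dab -s0 -s1; case: p => [d|c]; last first.
    by rewrite -[inr c]/(phi (inr c)) codom_f.
  rewrite -[d](permKV s); move: (s^-1 d)%g => {}d.
  have shape (q : 'I_k + 'I_l) e : inl (s e) = phi q -> exists d', e = rshift 2 d'.
    by case: q => [d'|//] [/perm_inj->]; exists d'.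
  rewrite ![inl _ == inl _](inj_eq inl_inj) !(inj_eq perm_inj).
  case: (ord2P d) => [->|->|[d' ->]]; rewrite ?eqxx ?orbT.
  - by apply/negP => /codomP[q /shape[d']].
  - by apply/negP => /codomP[q /shape[d']].
  - by rewrite -[inl _]/(phi (inl d')) codom_f.
have [D' D'P] := restrict_diag phiI cod.
exists (s^-1)%g, D' => K t; rewrite btens_bdiag bcomp_bdiag.
apply/esym; apply: stack_diag_two_colours => i h.
pose j0 : idx 2 (2 + k) := [ffun c => i (s c)].
have -> : agree D i h = agree (juxt_diag cup_diag D') j0 h.
  rewrite agree_juxt agree_cup.
  rewrite (D'P _ i h (@ridx _ 2 k j0) (@ridx _ 0 l h)); last first.
    by case=> c; rewrite /= !ffunE ?rshift0.
  rewrite Dab /= -s0 -s1 !ffunE.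
  by congr ((i (s _) == i (s _)) && _); apply: val_inj.
have -> : [set j | agree (perm_diag s^-1) i j && agree (juxt_diag cup_diag D') j h] =
    if agree (juxt_diag cup_diag D') j0 h then [set j0] else set0.
  apply/setP => j; rewrite !inE agree_perm.
  have -> : (i == [ffun c => j ((s^-1)%g c)]) = (j == j0).
    apply/eqP/eqP => ij; apply/ffunP => c.
      by rewrite ffunE ij ffunE permK.
    by rewrite ij !ffunE permKV.
  case: (eqVneq j j0) => [->|/negbTE jj]; rewrite ?andbT ?andbF //=.
    by case: ifP; rewrite inE ?eqxx.
  by case: ifP; rewrite inE ?jj.
by case: ifP; rewrite ?cards1 ?cards0.
Qed.

(** With no arc inside a row, [D] consists of two inverse bijections [F] and [G] between the rows.
    The equality [k = l] which they force is only propositional, hence the cast. *)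
Lemma through_diag k l (D : arcdiag k l) :
    (forall a b, D (inl a) != inl b) -> (forall a b, D (inr a) != inr b) ->
  exists e : k = l, exists s : 'S_l, D = ecast k (arcdiag k l) (esym e) (perm_diag s).
Proof.
move=> up lo; have DK p := (partnerP D p).1.
have f a : {b | D (inl a) = inr b}.
  by case E: (D (inl a)) => [b|b]; [have := up a b; rewrite E eqxx|exists b].
have g b : {a | D (inr b) = inl a}.
  by case E: (D (inr b)) => [a|a]; [exists a|have := lo b a; rewrite E eqxx].
pose F a := sval (f a); pose G b := sval (g b).
have FE a : D (inl a) = inr (F a) by rewrite /F; case: (f a).
have GE b : D (inr b) = inl (G b) by rewrite /G; case: (g b).
have FK : cancel F G by move=> a; have := DK (inl a); rewrite FE GE => -[].
have GK : cancel G F by move=> b; have := DK (inr b); rewrite GE FE => -[].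
have e : k = l by rewrite -[k]card_ord -[l]card_ord (bij_eq_card (Bijective FK GK)).
clearbody F G; exists e; case: l / e D F G {up lo DK f g} FE GE FK GK => D F G FE GE FK GK.
exists (perm (can_inj FK)); apply: eq_arcdiag => -[a|b]; rewrite ffunE /= ?FE ?GE.
  by rewrite permE.
by congr inl; apply: (can_inj FK); rewrite GK -[in RHS](permE (can_inj FK)) permKV.
Qed.

End DiagramCalculus.

(** * Uniqueness of the specialization functor *)

Section Uniqueness.
Variables (K : fieldType) (m : nat).
Local Notation idx k := {ffun 'I_k -> 'I_m}.

(** The basis tensor e_(i 0) (x) ... (x) e_(i (k - 1)). *)
Definition tdelta k (i : idx k) : tpower K m k := [ffun j => (j == i)%:R].

Lemma sum_tdelta k (u : tpower K m k) : u = \sum_i u i *: tdelta i.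
Proof.
apply/ffunP => j; rewrite sum_ffunE (bigD1 j) //= big1 ?addr0 => [|i /negbTE ij].
  by rewrite !ffunE eqxx /GRing.scale /= mulr1.
by rewrite !ffunE eq_sym ij /GRing.scale /= mulr0.
Qed.

Lemma eq_hom_tdelta k (V : vectType K) (f g : 'Hom(tpower K m k, V)) :
  (forall i, f (tdelta i) = g (tdelta i)) -> f = g.
Proof.
move=> fg; apply/lfunP => u; rewrite [u]sum_tdelta !linear_sum.
by apply: eq_bigr => i _; rewrite !linearZ /= fg.
Qed.

Lemma tdeltaD k l (i : idx (k + l)) :
  tdelta i = tmul (tdelta (lidx i)) (tdelta (ridx i)).
Proof.
apply/ffunP => j; rewrite !ffunE -natrM mulnb -/(lidx j) -/(ridx j); congr (nat_of_bool _)%:R.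
apply/eqP/andP => [->//|[/eqP jl /eqP jr]]; have [g _ gK] := @jidx_bij m k l.
apply/ffunP => x; rewrite -(splitK x); case: (split x) => a /=.
  by have /ffunP/(_ a) := jl; rewrite !ffunE.
by have /ffunP/(_ a) := jr; rewrite !ffunE.
Qed.

(** Basis tensors are products by [tdeltaD], so the values on products, which the tensor axiom of a
    specialization prescribes, determine a linear map. *)
Lemma eq_hom_tmul k l (V : vectType K) (f g : 'Hom(tpower K m (k + l), V)) :
  (forall u v, f (tmul u v) = g (tmul u v)) -> f = g.
Proof. by move=> fg; apply: eq_hom_tdelta => i; rewrite tdeltaD fg. Qed.

Lemma tdelta1 (i : idx 1) : tdelta i = tbase K (i ord0).
Proof.
apply/ffunP => j; rewrite !ffunE !mxE eqxx andbT; congr (nat_of_bool _)%:R.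
apply/eqP/eqP => [->//|ji]; apply/ffunP => a.
by rewrite ord1.
Qed.

Lemma tdelta0 (i : idx 0) : tdelta i = tone K m.
Proof.
by apply/ffunP => j; rewrite !ffunE; have -> : j == i by apply/eqP/ffunP => -[].
Qed.

Variable F : specialization K m.

(** The class of morphisms on which [F] agrees with the explicit functor; it contains the generators
    and is closed under [bcomp] and [btens]. *)
Let known k l (f : bhom K k l) := F k l f = spec0 m f.

Lemma known_comp k l n (g : bhom K l n) (f : bhom K k l) :
  known g -> known f -> known (bcomp m%:R g f).
Proof. by rewrite /known spec_comp spec0_comp => -> ->. Qed.

Lemma known_tens k1 l1 k2 l2 (f : bhom K k1 l1) (g : bhom K k2 l2) :
  known f -> known g -> known (btens f g).
Proof.
move=> fk gk; apply: eq_hom_tmul => u v.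
by rewrite spec_tens spec0_tens fk gk.
Qed.

Lemma known_id k : known (bid K k).
Proof. by rewrite /known spec_id spec0_id. Qed.

Lemma known_cross : known (bcross K).
Proof.
apply: (@eq_hom_tmul 1 1) => u v.
by rewrite -/(tmul2 u v) spec_cross spec0_cross.
Qed.

Lemma known_cup : known (bcup K).
Proof.
apply: (@eq_hom_tdelta 2) => i; rewrite (@tdeltaD 1 1) !tdelta1.
by rewrite -/(tmul2 _ _) spec_cup spec0_cup.
Qed.

Lemma known_cap : known (bcap K).
Proof. by apply: eq_hom_tdelta => i; rewrite tdelta0 spec_cap spec0_cap. Qed.

Lemma tperm01_diag n : bdiag K (perm_diag (tperm ord0 (lift ord0 ord0) : 'S_n.+2)) =
  btens (bcross K) (bid K n).
Proof.
rewrite btens_bdiag; congr bdiag; apply: eq_arcdiag => p.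
rewrite -[p](@unjuxtK 2 2 n n); move: (unjuxt _) => {}p.
have tl (a : 'I_2) : tperm ord0 (lift ord0 ord0) (lshift n a) =
    lshift n (tperm ord0 ord_max a) :> 'I_n.+2.
  rewrite (inj_tperm _ _ _ (@lshift_inj 2 n)).
  by congr (tperm _ _ _); apply: val_inj.
have tr (a : 'I_n) : tperm ord0 (lift ord0 ord0) (rshift 2 a) = rshift 2 a :> 'I_n.+2.
  by rewrite tpermD.
rewrite ffunE [RHS]ffunE /juxt_pt juxtK.
by case: p => -[] a; rewrite /= !ffunE /= ?tpermV ?invg1 ?perm1 ?tl ?tr.
Qed.

Lemma lift_perm_diag n (s : 'S_n) : bdiag K (perm_diag (lift_perm ord0 ord0 s)) =
  btens (bid K 1) (bdiag K (perm_diag s)).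
Proof.
rewrite btens_bdiag; congr bdiag; apply: eq_arcdiag => p.
rewrite -[p](@unjuxtK 1 1 n n); move: (unjuxt _) => {}p.
have l0 : lshift n (ord0 : 'I_1) = ord0 :> 'I_n.+1 by apply: val_inj.
have lr (d : 'I_n) : rshift 1 d = lift ord0 d :> 'I_n.+1 by apply: val_inj.
rewrite ffunE [RHS]ffunE /juxt_pt juxtK.
case: p => -[] a; rewrite /= !ffunE /= ?invg1 ?perm1 ?lift_permV ?(ord1 a) ?l0 ?lr.
all: by rewrite ?lift_perm_id ?lift_perm_lift.
Qed.

(** Induction on [n]. Permutations fixing 0 come from [n] points by adding a strand, and the
    transposition (0 1) from the crossing. Every other (0 a) is a conjugate of (0 1), and [s]
    differs from a permutation fixing 0 by such a transposition. *)
Lemma known_perm n (s : 'S_n) : known (bdiag K (perm_diag s)).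
Proof.
elim: n s => [|n IH] s.
  by have -> : s = 1%g; [apply/permP => -[]|exact: known_id].
have M u v : known (bdiag K (perm_diag u)) -> known (bdiag K (perm_diag v)) ->
    known (bdiag K (perm_diag (u * v : 'S_n.+1)%g)).
  by move=> ku kv; rewrite -(perm_diagM m%:R); apply: known_comp.
have fix0 (u : 'S_n.+1) : u ord0 = ord0 -> known (bdiag K (perm_diag u)).
  move=> u0.
  suff [v ->] : exists v, u = lift_perm ord0 ord0 v.
    rewrite lift_perm_diag; exact: (@known_tens 1 1 n n _ _ (known_id 1) (IH v)).
  (* The default [a] is never taken: [u] fixes [ord0], so it sends no lifted point there. *)
  have lK a : lift ord0 (odflt a (unlift ord0 (u (lift ord0 a)))) = u (lift ord0 a).
    case: unliftP => [b ->//|]; rewrite -[X in _ = X]u0 => /perm_inj.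
    by move/eqP; rewrite eq_sym (negbTE (neq_lift _ _)).
  have inj : injective (fun a => odflt a (unlift ord0 (u (lift ord0 a)))).
    move=> a b /(congr1 (lift ord0)); rewrite !lK => /perm_inj; exact: lift_inj.
  exists (perm inj); apply/permP => a; case: (unliftP ord0 a) => [b|] ->.
    by rewrite lift_perm_lift permE lK.
  by rewrite lift_perm_id.
have t0 (a : 'I_n.+1) : known (bdiag K (perm_diag (tperm ord0 a))).
  case: n {s IH} M fix0 a => [|n] M fix0 a.
    by rewrite (ord1 a) tperm1; exact: known_id.
  case: (ord2P a) => [->|->|[d ->]].
  - by rewrite tperm1; exact: known_id.
  - by rewrite tperm01_diag; exact: (@known_tens 2 2 n n _ _ known_cross (known_id n)).
  pose b : 'I_n.+2 := rshift 2 d; pose c : 'I_n.+2 := lift ord0 ord0.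
  (* Conjugation of (0 1) by the transposition of [c], which is 1, and [b]; the latter fixes 0. *)
  have -> : tperm ord0 (rshift 2 d) = (tperm c b * tperm ord0 c * tperm c b)%g.
    have := tpermJ ord0 c (tperm c b); rewrite tpermL tpermD // => <-.
    by rewrite conjgE tpermV mulgA.
  have kcb : known (bdiag K (perm_diag (tperm c b))) by apply: fix0; rewrite tpermD.
  apply: (M) => //; apply: (M) => //.
  by rewrite tperm01_diag; exact: (@known_tens 2 2 n n _ _ known_cross (known_id n)).
have -> : s = (s * tperm ord0 (s ord0) * tperm ord0 (s ord0))%g.
  by rewrite -mulgA tperm2 mulg1.
by apply: M (t0 _); apply: fix0; rewrite permM tpermR.
Qed.

(** Strong induction on the number of points: caps and cups are peeled off until no arc stays inside
    a row, and a permutation remains. *)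
Lemma known_diag k l (D : arcdiag k l) : known (bdiag K D).
Proof.
have [N] := ubnP (k + l)%N; elim: N k l D => // N IH k l D klN.
case: (pickP (fun ab => D (inr ab.1) == inr ab.2)) => [[a b] /eqP /= Dab|lo].
  case: l D a b Dab klN => [|[|l]] D a b Dab klN; first by case: a Dab.
    by have := (partnerP D (inr a)).2; rewrite Dab (ord1 a) (ord1 b) eqxx.
  have [s [D' DE]] := peel_cap Dab; rewrite (DE K m%:R).
  apply: known_comp (known_perm s) (@known_tens 0 2 k l _ _ known_cap (IH _ _ _ _)).
  by lia.
case: (pickP (fun ab => D (inl ab.1) == inl ab.2)) => [[a b] /eqP /= Dab|up].
  case: k D a b Dab klN {lo} => [|[|k]] D a b Dab klN; first by case: a Dab.
    by have := (partnerP D (inl a)).2; rewrite Dab (ord1 a) (ord1 b) eqxx.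
  have [s [D' DE]] := peel_cup Dab; rewrite (DE K m%:R).
  apply: known_comp (@known_tens 2 0 k l _ _ known_cup (IH _ _ _ _)) (known_perm s).
  by lia.
have [a b|a b|e [s Ds]] := @through_diag _ _ D; first exact: negbT (up (a, b)).
  exact: negbT (lo (a, b)).
rewrite {}Ds; move: (esym e) => e' {D klN lo up e}.
by case: k / e'; exact: known_perm.
Qed.

Lemma specialization_unique k l (f : bhom K k l) : F k l f = spec0 m f.
Proof.
rewrite (sum_bdiag f) linear_sum /= -[spec0 m _]/(spec_lin K m k l _) linear_sum.
by apply: eq_bigr => D _; rewrite !linearZ /=; congr (_ *: _); apply: known_diag.
Qed.

End Uniqueness.

(** * Trace polynomials in coordinates *)

Section TraceEvaluation.
Variables (K : fieldType) (m : nat) (A : 'M[K]_m).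
Local Notation idx k := {ffun 'I_k -> 'I_m}.

(** The value of the trace polynomial on a basis tensor; the indices are swapped because tr (E_ab A)
    = A_ba. *)
Definition trace_monomial w (j : idx (w * 2)) : K :=
  \prod_(r < w) A (j (mxtens_index (r, ord_max))) (j (mxtens_index (r, ord0))).

(** The linear functional u |-> [trace_poly] (f u) A, evaluated at the [i]-th basis tensor. *)
Definition trace_pullback k w (f : bhom K k (w * 2)) (i : idx k) : K :=
  \sum_j kc f i j * trace_monomial j.

Lemma mxtrace_delta_mul (a b : 'I_m) : \tr (delta_mx a b *m A) = A b a.
Proof.
rewrite /mxtrace (bigD1 a) //= big1 ?addr0 => [|c /negbTE ca]; last first.
  by rewrite mxE big1 // => d _; rewrite mxE ca mul0r.
rewrite mxE (bigD1 b) //= big1 ?addr0 => [|c /negbTE cb].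
  by rewrite mxE !eqxx mul1r.
by rewrite mxE cb andbF mul0r.
Qed.

Lemma trace_poly_spec0 k w (f : bhom K k (w * 2)) (u : tpower K m k) :
  trace_poly (spec0 m f u) A = \sum_i u i * trace_pullback f i.
Proof.
rewrite /trace_poly; under eq_bigr => j _.
  rewrite spec0E (eq_bigr _ (fun r _ => mxtrace_delta_mul _ _)) -/(trace_monomial j).
  rewrite mulr_suml; over.
rewrite exchange_big /=; apply: eq_bigr => i _; rewrite mulr_sumr.
by apply: eq_bigr => j _; rewrite mulrAC mulrC.
Qed.

Lemma trace_monomialS w (j : idx (w.+1 * 2)) :
  trace_monomial j =
  A (@lidx _ 2 (w * 2) j ord_max) (@lidx _ 2 (w * 2) j ord0) *
  trace_monomial (@ridx _ 2 (w * 2) j).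
Proof.
rewrite /trace_monomial big_ord_recl /= !ffunE; congr (A (j _) (j _) * _).
- exact: val_inj.
- exact: val_inj.
by apply: eq_bigr => r _; rewrite !ffunE; congr (A (j _) (j _)); apply: val_inj;
  rewrite /= /bump /= add1n mulSn addnA.
Qed.

Lemma trace_pullback_comp k l w (g : bhom K l (w * 2)) (f : bhom K k l) i :
  trace_pullback (bcomp m%:R g f) i = \sum_j kc f i j * trace_pullback g j.
Proof.
rewrite /trace_pullback; under eq_bigr do rewrite kc_comp mulr_suml.
rewrite exchange_big /=; apply: eq_bigr => j _; rewrite mulr_sumr.
by apply: eq_bigr => h _; rewrite mulrA.
Qed.

(** Permuting the blocks only reorders the commuting factors of the monomial. *)
Lemma trace_pullback_perm w (s : 'S_w) (i : idx (w * 2)) :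
  trace_pullback (bdiag K (perm_diag (block_perm 2 s))) i = trace_monomial i.
Proof.
pose j0 : idx (w * 2) := [ffun a => i ((block_perm 2 s)^-1%g a)].
rewrite /trace_pullback (bigD1 j0) //= big1 ?addr0 => [|j jj]; last first.
  rewrite kc_diag agree_perm; case: eqP => [ij|_]; last by rewrite mul0r.
  case/eqP: jj; apply/ffunP => a; rewrite ffunE ij ffunE permKV.
  by [].
rewrite kc_diag agree_perm.
have -> : i == [ffun a => j0 (block_perm 2 s a)].
  by apply/eqP/ffunP => a; rewrite !ffunE permK.
rewrite mul1r /trace_monomial (reindex_inj (@perm_inj _ s)) /=.
have jE r c : j0 (mxtens_index (s r, c)) = i (mxtens_index (r, c)).
  rewrite ffunE; congr (i _); apply: (@perm_inj _ (block_perm 2 s)).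
  by rewrite permKV permE /block_pt mxtens_indexK.
by apply: eq_bigr => r _; rewrite !jE.
Qed.

(** The hypothesis says that the entry functional of [A] on one block is an eigenvector of [f] with
    eigenvalue [a]; the blocks contribute independently. *)
Lemma trace_pullback_btpow (f : bhom K 2 2) a :
    (forall q : idx 2, \sum_(p : idx 2) kc f q p * A (p ord_max) (p ord0) =
      a * A (q ord_max) (q ord0)) ->
  forall w (i : idx (w * 2)),
    trace_pullback (btpow f w) i = a ^+ w * trace_monomial i.
Proof.
move=> fP; elim=> [|w IH] i.
  rewrite /trace_pullback /trace_monomial big_ord0 expr0 mul1r.
  rewrite (bigD1 i) //= kc_id eqxx mul1r big_ord0 big1 ?addr0 // => j /eqP[].
  by apply/ffunP => -[].
rewrite trace_monomialS /trace_pullback.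
rewrite (reindex _ (onW_bij _ (jidx_bij m 2 (w * 2)))) /=.
under eq_bigr => p _ do rewrite trace_monomialS (kc_tens f (btpow f w)).
have [g gK _] := jidx_bij m 2 (w * 2).
have lE (p : idx 2 * idx (w * 2)) : lidx (jidx p) = p.1.
  by apply/ffunP => b; rewrite !ffunE (unsplitK (inl b)).
have rE (p : idx 2 * idx (w * 2)) : ridx (jidx p) = p.2.
  by apply/ffunP => b; rewrite !ffunE (unsplitK (inr b)).
under eq_bigr => p _ do rewrite lE rE mulrACA.
rewrite -(pair_big xpredT xpredT (fun p q => (kc f (lidx i) p * A (p ord_max) (p ord0)) *
  (kc (btpow f w) (ridx i) q * trace_monomial q))) /=.
rewrite -big_distrlr /= fP -/(trace_pullback _ _) IH exprS.
by rewrite mulrACA.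
Qed.

Hypothesis A_so : A^T = - A.

Lemma skew_entry a b : A a b = - A b a.
Proof. by have := congr1 (fun B : 'M_m => B b a) A_so; rewrite !mxE. Qed.

(** On each block id - c turns A_ba into A_ba - A_ab, which is 2 A_ba for skew [A], and each of the
    [w!] block permutations fixes the monomial. *)
Lemma trace_pullback_sym_wedge w (i : idx (w * 2)) :
  trace_pullback (bsym_wedge m%:R w) i = w`!%:R * 2%:R ^+ w * trace_monomial i.
Proof.
rewrite /trace_pullback /bsym_wedge.
under eq_bigr do rewrite kc_sum mulr_suml.
rewrite exchange_big /=.
under eq_bigr => s _.
  rewrite -/(trace_pullback _ _) trace_pullback_comp.
  under eq_bigr do rewrite trace_pullback_perm.
  rewrite -/(trace_pullback _ _).
  rewrite (@trace_pullback_btpow _ 2%:R); first over.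
  move=> q; pose q' : idx 2 := [ffun a => q (tperm ord0 ord_max a)].
  have kcE p : kc (bid K 2 - bcross K) q p = (q == p)%:R - (p == q')%:R.
    rewrite -[- bcross K]scaleN1r addrC kcP kc_id kc_diag agree_perm mulN1r addrC.
    congr (_ - _%:R); congr nat_of_bool; apply/eqP/eqP => pq; apply/ffunP => a.
      by rewrite ffunE pq ffunE tpermK.
    by rewrite pq !ffunE tpermK.
  under eq_bigr do rewrite kcE mulrBl.
  rewrite sumrB (bigD1 q) //= eqxx mul1r big1 ?addr0 => [|p /negbTE pq]; last first.
    by rewrite eq_sym pq mul0r.
  rewrite (bigD1 q') //= eqxx mul1r big1 ?addr0 => [|p /negbTE pq]; last first.
    by rewrite pq mul0r.
  rewrite !ffunE tpermL tpermR [A (q ord0) _]skew_entry opprK.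
  by rewrite mulr_natl.
by rewrite sumr_const card_Sn -mulrA mulr_natl.
Qed.

End TraceEvaluation.

(** * Sums over colourings as sums over words *)

Section Tuples.
Variables (V : nmodType) (T : finType).

Lemma big_tuple0 (Phi : seq T -> V) : \sum_(t : 0.-tuple T) Phi t = Phi [::].
Proof. by rewrite (bigD1 [tuple]) //= big1 ?addr0 // => t /eqP[]; exact: tuple0. Qed.

Lemma big_tupleS n (Phi : seq T -> V) :
  \sum_(t : n.+1.-tuple T) Phi t = \sum_x \sum_(t : n.-tuple T) Phi (x :: t).
Proof.
rewrite (pair_big xpredT xpredT (fun x (t : n.-tuple T) => Phi (x :: t))) /=.
rewrite (reindex (fun p : T * n.-tuple T => [tuple of p.1 :: p.2])) //.
exists (fun t : n.+1.-tuple T => (thead t, [tuple of behead t])) => [[x t]|t] _.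
  by congr pair; apply: val_inj.
by rewrite [RHS]tuple_eta.
Qed.

Lemma big_ffun_tuple n (Phi : seq T -> V) :
  \sum_(j : {ffun 'I_n -> T}) Phi (codom j) = \sum_(t : n.-tuple T) Phi t.
Proof.
rewrite (reindex (fun t : n.-tuple T => finfun (tnth t))) /=.
  apply: eq_bigr => t _; congr Phi; rewrite /codom /image_mem -[RHS]map_tnth_enum.
  by apply: eq_map => a; rewrite ffunE.
exists (fun j : {ffun 'I_n -> T} => [tuple j a | a < n]) => [t|j] _.
  by apply: eq_from_tnth => a; rewrite tnth_mktuple ffunE.
by apply/ffunP => a; rewrite ffunE tnth_mktuple.
Qed.

End Tuples.

(** * Evaluation of paths and cycles of arcs *)

Section ArcEvaluation.

(* Points are read in a single word [i0 :: i1 :: j] of colours *)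
Definition word_pos (p : nat + nat) : nat :=
  match p with inl n => n | inr n => n.+2 end.

Definition arcs_agree (T : eqType) (d : T) (t : seq T)
    (s : seq ((nat + nat) * (nat + nat))) : bool :=
  all (fun a => nth d t (word_pos a.1) == nth d t (word_pos a.2)) s.

Lemma arcs_agree_cat (T : eqType) (d : T) t s1 s2 :
  arcs_agree d t (s1 ++ s2) = arcs_agree d t s1 && arcs_agree d t s2.
Proof. exact: all_cat. Qed.

Lemma nth_pt_pos m k (i : {ffun 'I_2 -> 'I_m}) (j : {ffun 'I_k -> 'I_m}) d p :
  nth d [:: i ord0, i ord_max & codom j] (word_pos (pt_pos p)) = pt_col i j p.
Proof.
case: p => [a|b] /=; first by case: (@ord2P 0 a) => [->|->|[[]//]] //=; congr (i _); apply: val_inj.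
by rewrite (nth_map b) ?nth_ord_enum // size_enum_ord.
Qed.

(** Every point is an end of a listed arc, so the list exhausts the arcs of [D]. *)
Lemma agree_arcs m k (D : arcdiag 2 k) s (i : {ffun 'I_2 -> 'I_m}) j d :
    has_arcs D s -> (forall p : 'I_2 + 'I_k, pt_pos p \in arc_ends s) ->
  agree D i j = arcs_agree d [:: i ord0, i ord_max & codom j] s.
Proof.
move=> /allP sD ends; apply/agreeP/allP => [ag a sa|ag p].
  have /existsP[p /andP[/eqP <- /eqP <-]] := sD _ sa.
  by rewrite !nth_pt_pos ag.
have /flattenP[_ /mapP[a sa ->] pa] := ends p.
have /existsP[q /andP[/eqP qa /eqP Dqa]] := sD _ sa.
have := ag _ sa; rewrite -qa -Dqa !nth_pt_pos => /eqP qE.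
move: pa; rewrite -qa -Dqa !inE => /orP[] /eqP/pt_pos_inj ->; first by rewrite qE.
by rewrite (partnerP D q).1.
Qed.

(* The arcs of a path of [M] blocks from [a] to [b], one block at a time; both
   [path_arcs] and, up to order, [cycle_arcs] are of this form. *)
Fixpoint chain_arcs a off M b : seq ((nat + nat) * (nat + nat)) :=
  if M is M'.+1 then (a, inr off) :: chain_arcs (inr off.+1) off.+2 M' b
  else [:: (a, b)].

Lemma chain_arcs_inner off M b : chain_arcs (inr off.+1) off.+2 M b =
  [seq inner_arc off j | j <- iota 1 M] ++ [:: (inr (off + M.*2.+1)%N, b)].
Proof.
elim: M off => [|M IH] off; first by rewrite /= addn1.
have -> : iota 1 M.+1 = 1%N :: [seq 1 + j | j <- iota 1 M]%N.
  by rewrite -iotaDl.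
rewrite [LHS]/= IH map_cons -map_comp cat_cons; congr cons.
  by rewrite /inner_arc addn1 addn2.
congr (_ ++ [:: (inr _, _)]); last by lia.
apply/eq_in_map => j; rewrite mem_iota => /andP[j1 _]; rewrite /inner_arc /=.
by congr (inr _, inr _); lia.
Qed.

Lemma path_arcsE M : path_arcs M = chain_arcs (inl 0%N) 0 M (inl 1%N).
Proof. by case: M => //= M; rewrite chain_arcs_inner. Qed.

(** A cycle is a chain from its second point back to its first. The closing arc stands first in the
    cycle, and last and reversed in the chain. *)
Lemma cycle_arcs_agree (T : eqType) (d : T) t off l :
  arcs_agree d t (cycle_arcs off l.+1) =
  arcs_agree d t (chain_arcs (inr off.+1) off.+2 l (inr off)).
Proof.
by rewrite chain_arcs_inner /arcs_agree all_cat /= andbT andbC eq_sym.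
Qed.

Variables (K : fieldType) (m : nat) (A : 'M[K]_m).

Fixpoint word_monomial (s : seq 'I_m) : K :=
  if s is x :: y :: s' then A y x * word_monomial s' else 1.

Lemma trace_monomialE w (j : {ffun 'I_(w * 2) -> 'I_m}) :
  trace_monomial A j = word_monomial (codom j).
Proof.
elim: w j => [|w IH] j.
  by rewrite /trace_monomial big_ord0 /codom /image_mem enum_ord0.
rewrite trace_monomialS IH.
have -> : codom j = [:: @lidx _ 2 (w * 2) j ord0, @lidx _ 2 (w * 2) j ord_max &
                       codom (@ridx _ 2 (w * 2) j)].
  rewrite /codom /image_mem (@enum_ordSl (w * 2).+1) /= (@enum_ordSl (w * 2)) /=.
  rewrite !ffunE -!map_comp; congr [:: j _, j _ & _]; try exact: val_inj.
  by apply: eq_map => a; rewrite /= !ffunE; congr (j _); apply: val_inj.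
by [].
Qed.

Variable d : 'I_m.

Definition word_sum (L : nat) (Phi : seq 'I_m -> K) :=
  \sum_(t : (L * 2).-tuple 'I_m) word_monomial t * Phi t.

Lemma word_sumS L Phi :
  word_sum L.+1 Phi =
  \sum_x \sum_y A y x * word_sum L (fun t => Phi [:: x, y & t]).
Proof.
rewrite /word_sum (@big_tupleS _ _ (L * 2).+1 (fun t => word_monomial t * Phi t)).
apply: eq_bigr => x _.
rewrite (@big_tupleS _ _ (L * 2) (fun t => word_monomial (x :: t) * Phi (x :: t))).
by apply: eq_bigr => y _; rewrite mulr_sumr; apply: eq_bigr => t _; rewrite mulrA.
Qed.

Lemma eq_word_sum L Phi Psi : Phi =1 Psi -> word_sum L Phi = word_sum L Psi.
Proof. by move=> PP; apply: eq_bigr => t _; rewrite PP. Qed.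

Let colour (pre : seq 'I_m) p := nth d pre (word_pos p).

(** [pre] holds the colours of the two upper points and of the first [off] lower points, [t] those
    of the points still to be summed over. *)
Let cyc nu off := fun pre t => (arcs_agree d (pre ++ t) (cycles_arcs off nu))%:R : K.

(** Each block of the chain contributes one matrix product: its entering arc forces the first
    colour, and the sum over the second one, [y], weighted by [A y x], lengthens the power of [A] by
    one. *)
Lemma chain_sum nu :
    (forall off pre, size pre = off.+2 ->
      word_sum (sumn nu) (cyc nu off pre) = \prod_(l <- nu) \tr (A ^+ l)) ->
  forall M a off b pre, size pre = off.+2 ->
    (word_pos a < off.+2)%N -> (word_pos b < off.+2)%N ->
    word_sum (M + sumn nu) (fun t =>
      (arcs_agree d (pre ++ t) (chain_arcs a off M b ++ cycles_arcs (off + M.*2) nu))%:R) =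
    (A ^+ M) (colour pre b) (colour pre a) * \prod_(l <- nu) \tr (A ^+ l).
Proof.
move=> cycP; elim=> [|M IH] a off b pre szp ap bp.
  rewrite addn0 -(cycP off pre szp) expr0 mxE /word_sum mulr_sumr.
  apply: eq_bigr => t _; rewrite /arcs_agree /= !nth_cat szp ap bp -mulnb natrM.
  by rewrite mulrCA eq_sym.
rewrite addSn word_sumS exprSr mxE mulr_suml exchange_big /=.
(* Only [x = colour pre a] satisfies the arc from [a] to the block. *)
apply: eq_bigr => y _; rewrite (bigD1 (colour pre a)) //= [X in _ + X]big1 ?addr0.
  rewrite (@eq_word_sum (M + sumn nu) _ (fun t => (arcs_agree d ((pre ++ [:: colour pre a; y]) ++ t)
    (chain_arcs (inr off.+1) off.+2 M b ++ cycles_arcs (off.+2 + M.*2) nu))%:R)).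
    rewrite IH ?size_cat ?szp ?addn2 //=; try lia.
    rewrite /colour !nth_cat szp bp ltnNge leqnSn /=.
    have -> : (off.+3 - off.+2)%N = 1%N by lia.
    by rewrite mulrCA mulrA.
  move=> t; rewrite -catA /= {1}/arcs_agree /= !nth_cat szp ap ltnn subnn /= eqxx /=.
  by congr (arcs_agree _ _ (_ ++ cycles_arcs _ _))%:R; lia.
move=> x xa; rewrite /word_sum big1 ?mulr0 // => t _.
rewrite /arcs_agree /= !nth_cat szp ap ltnn subnn /= eq_sym.
by rewrite (negbTE xa) mulr0.
Qed.

(** Once the first block x, y of a cycle is fixed, the rest is a chain from [y] to [x], with value
    (A^l)_xy; the sum of (A^l)_xy A_yx is the trace of the next power. *)
Lemma cycles_sum nu off pre : all (fun l => 0 < l)%N nu -> size pre = off.+2 ->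
  word_sum (sumn nu) (cyc nu off pre) = \prod_(l <- nu) \tr (A ^+ l).
Proof.
elim: nu off pre => [|l nu IH] off pre.
  rewrite big_nil /word_sum (big_tuple0 (fun t => word_monomial t * cyc [::] off pre t)).
  by rewrite mulr1.
case: l => // l /= nu0 szp.
have nuP o p : size p = o.+2 ->
    word_sum (sumn nu) (cyc nu o p) = \prod_(l <- nu) \tr (A ^+ l).
  by move=> sp; apply: IH.
rewrite addSn word_sumS big_cons exprSr /mxtrace mulr_suml.
apply: eq_bigr => x _; rewrite mxE mulr_suml; apply: eq_bigr => y _.
rewrite (@eq_word_sum (l + sumn nu) _ (fun t => (arcs_agree d ((pre ++ [:: x; y]) ++ t)
    (chain_arcs (inr off.+1) off.+2 l (inr off) ++ cycles_arcs (off.+2 + l.*2) nu))%:R)).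
  rewrite chain_sum ?size_cat ?szp ?addn2 //=; try lia.
  rewrite /colour !nth_cat szp /= ltnn subnn ltnNge leqnSn /=.
  have -> : (off.+3 - off.+2)%N = 1%N by lia.
  by rewrite mulrCA mulrA.
move=> t; rewrite /cyc -catA.
rewrite -[cycles_arcs off (_ :: _)]/(cycle_arcs off l.+1 ++ cycles_arcs (off + l.+1.*2) nu).
rewrite !arcs_agree_cat.
by rewrite cycle_arcs_agree doubleS !addSn !addnS.
Qed.

End ArcEvaluation.

(** * Evaluation of the diagrams x_{M, nu} *)

Section XEvaluation.
Variables (K : fieldType) (m : nat) (A : 'M[K]_m).

Lemma trace_pullback_x_hom w nu (i : {ffun 'I_2 -> 'I_m}) :
    even_partition nu -> (sumn nu <= w)%N ->
  trace_pullback A (x_hom K (w * 2) (w - sumn nu) nu) i =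
  (A ^+ (w - sumn nu)) (i ord_max) (i ord0) * \prod_(l <- nu) \tr (A ^+ l).
Proof.
move=> nuE nuw; have [D DP] := x_arcs_unique nuE nuw.
have nu0 : all (fun l => 0 < l)%N nu by case/andP: nuE => _; apply: sub_all => l /andP[].
rewrite /trace_pullback /x_hom (eq_bigl _ _ DP) big_pred1_eq.
have ends (p : 'I_2 + 'I_(w * 2)) : pt_pos p \in arc_ends (x_arcs (w - sumn nu) nu).
  rewrite (perm_mem (x_ends _ nu0)) !inE subnK //.
  case: p => [[[|[|//]] /=]|b] //=; rewrite map_f ?mem_iota ?orbT //= add0n.
  by rewrite -muln2.
set d := i ord0.
have DE : has_arcs D (x_arcs (w - sumn nu) nu) by rewrite DP.
under [LHS]eq_bigr => j _ do
  rewrite kc_diag (agree_arcs _ _ d DE ends) trace_monomialE mulrC.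
rewrite (big_ffun_tuple _ (fun t => word_monomial A t * (arcs_agree d [:: i ord0, i ord_max & t]
  (x_arcs (w - sumn nu) nu))%:R)).
have := @chain_sum _ _ A d nu (fun off pre => @cycles_sum _ _ A d nu off pre nu0)
  (w - sumn nu) (inl 0%N) 0 (inl 1%N) [:: i ord0; i ord_max] erefl erefl erefl.
by rewrite -path_arcsE add0n subnK.
Qed.

End XEvaluation.

(** * Evaluation of kappa *)

Section KappaEvaluation.
Variables (K : numFieldType) (m : nat) (A : 'M[K]_m).
Local Notation idx k := {ffun 'I_k -> 'I_m}.

Lemma big_perm2 (V : nmodType) (Phi : 'S_2 -> V) :
  \sum_s Phi s = Phi 1%g + Phi (tperm ord0 ord_max).
Proof.
rewrite (bigD1 1%g) //= (bigD1 (tperm ord0 ord_max)) /=; last first.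
  by apply: contraTneq isT => /permP/(_ ord0); rewrite tpermL perm1.
rewrite big1 ?addr0 // => s /andP[s1 st].
have o2 (a : 'I_2) : a = ord0 \/ a = ord_max.
  by case: a => -[|[|//]] ?; [left|right]; apply: val_inj.
suff : s = 1%g \/ s = tperm ord0 ord_max by case=> e; rewrite e eqxx in s1 st.
have s01 : s ord0 <> s ord_max by move/perm_inj.
by case: (o2 (s ord0)) => e0; case: (o2 (s ord_max)) => e1; rewrite e0 e1 // in s01;
  [left|right]; apply/permP => a; case: (o2 a) => ->; rewrite ?perm1 ?tpermL ?tpermR.
Qed.

Lemma trace_pullbackZ k w c (f : bhom K k (w * 2)) (i : idx k) :
  trace_pullback A (c *: f) i = c * trace_pullback A f i.
Proof.
by rewrite /trace_pullback mulr_sumr; apply: eq_bigr => j _; rewrite kcZ mulrA.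
Qed.

Lemma trace_pullback_sum (I : finType) (P : pred I) k w (f : I -> bhom K k (w * 2)) (i : idx k) :
  trace_pullback A (\sum_(s | P s) f s) i = \sum_(s | P s) trace_pullback A (f s) i.
Proof.
rewrite /trace_pullback exchange_big /=; apply: eq_bigr => j _.
by rewrite kc_sum mulr_suml.
Qed.

(** The idempotent is (1 - c) / 2, and for alternating [Phi] both terms contribute [Phi i / 2]. This
    is how the restriction to the exterior square is removed. *)
Lemma kc_alt_idem (Phi : idx 2 -> K) (i : idx 2) :
    (forall j : idx 2, Phi [ffun a => j (tperm ord0 ord_max a)] = - Phi j) ->
  \sum_j kc (bsym_idem (-1 : K) 2) i j * Phi j = Phi i.
Proof.
move=> alt; pose i' : idx 2 := [ffun a => i (tperm ord0 ord_max a)].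
under eq_bigr => j _.
  rewrite kcZ kc_sumZ big_perm2 odd_perm1 odd_tperm /= expr0 expr1 mul1r mulN1r.
  rewrite !kc_diag !agree_perm.
  have -> : [ffun a => j ((1%g : 'S_2) a)] = j by apply/ffunP => a; rewrite ffunE perm1.
  have -> : (i == [ffun a => j (tperm ord0 ord_max a)]) = (j == i').
    apply/eqP/eqP => ij; apply/ffunP => a.
      by rewrite ffunE ij ffunE tpermK.
    by rewrite ij !ffunE tpermK.
  rewrite -mulrA mulrBl; over.
rewrite -mulr_sumr sumrB (bigD1 i) //= eqxx mul1r big1 ?addr0 => [|p /negbTE pq]; last first.
  by rewrite eq_sym pq mul0r.
rewrite (bigD1 i') //= eqxx mul1r big1 ?addr0 => [|p /negbTE pq]; last first.
  by rewrite pq mul0r.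
by rewrite alt opprK -mulr2n -(mulr_natl (Phi i)) mulKf // pnatr_eq0.
Qed.

Lemma trmxX n : (A ^+ n)^T = A^T ^+ n.
Proof. by elim: n => [|n IH]; rewrite ?expr0 ?trmx1 // exprS exprSr trmx_mul IH. Qed.

Lemma sum_tmul2 (B : 'M[K]_m) (v1 v2 : 'cV[K]_m) :
  \sum_i tmul2 (tvec v1) (tvec v2) i * B (i ord_max) (i ord0) = stdform v2 (B *m v1).
Proof.
pose Phi (s : seq 'I_m) := if s is [:: a; b] then v1 a 0 * v2 b 0 * B b a else 0.
transitivity (\sum_(i : idx 2) Phi (codom i)).
  apply: eq_bigr => i _; rewrite /codom /image_mem !(@enum_ordSl 1) enum_ordSl enum_ord0 /=.
  rewrite !ffunE /=.
  by congr (v1 _ _ * v2 _ _ * B _ _); congr (i _); apply: val_inj.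
rewrite big_ffun_tuple big_tupleS /stdform mxE.
under eq_bigr do rewrite (big_tupleS _ (fun s => Phi (_ :: s))).
under eq_bigr do under eq_bigr do rewrite (big_tuple0 (fun s => Phi [:: _, _ & s])).
rewrite exchange_big /=; apply: eq_bigr => b _; rewrite !mxE mulr_sumr.
by apply: eq_bigr => a _; rewrite /=; ring.
Qed.

(** What is left of the trace polynomial of kappa after the scalar of [trace_poly_kappa] is taken
    out. *)
Definition kappa_poly w (v1 v2 : 'cV[K]_m) : K :=
  \sum_(n < w.+1)
  \sum_(u : n.-tuple 'I_w.+1 |
        let nu := map val u in even_partition nu && (sumn nu <= w)%N)
    let nu := map val u in
    kappa_coef (-1 : K) nu *
      (stdform v2 (A ^+ (w - sumn nu) *m v1) * \prod_(l <- nu) \tr (A ^+ l)).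

Lemma even_partition_sumn nu : even_partition nu -> ~~ odd (sumn nu).
Proof.
by case/andP => _; elim: nu => //= l nu IH /andP[/andP[_ l2] /IH]; rewrite oddD (negbTE l2).
Qed.

(** The factor [w! 2^w] comes from [bsym_wedge] and the last 2 from the coefficient of [x_hom]. *)
Lemma trace_poly_kappa w (v1 v2 : 'cV[K]_m) : A^T = - A -> odd w ->
  trace_poly (spec0 m (kappa m%:R (-1 : K) w) (tmul2 (tvec v1) (tvec v2))) A =
  w`!%:R * 2%:R ^+ w * 2%:R * kappa_poly w v1 v2.
Proof.
move=> A_so w_odd; rewrite trace_poly_spec0 /kappa.
pose term nu (i : idx 2) : K := (A ^+ (w - sumn nu)) (i ord_max) (i ord0) *
  \prod_(l <- nu) \tr (A ^+ l).
transitivity (\sum_i tmul2 (tvec v1) (tvec v2) i * (w`!%:R * 2%:R ^+ w * 2%:R *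
  \sum_(n < w.+1) \sum_(u : n.-tuple 'I_w.+1 |
        let nu := map val u in even_partition nu && (sumn nu <= w)%N)
    let nu := map val u in kappa_coef (-1 : K) nu * term nu i)).
  apply: eq_bigr => i _; congr (_ * _); rewrite trace_pullback_sum mulr_sumr.
  apply: eq_bigr => n _; rewrite trace_pullback_sum mulr_sumr.
  apply: eq_bigr => u /andP[]; move: (map _ _) => nu nuE nuw.
  rewrite trace_pullbackZ mulrCA; congr (_ * _); rewrite trace_pullback_comp.
  under eq_bigr do rewrite (trace_pullback_sym_wedge A_so) mulrCA.
  rewrite -mulr_sumr -/(trace_pullback _ _ _) -[RHS]mulrA; congr (_ * _).
  rewrite trace_pullback_comp.
  under eq_bigr do rewrite trace_pullbackZ mulrCA.
  rewrite -mulr_sumr; congr (_ * _).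
  under eq_bigr do rewrite (trace_pullback_x_hom _ _ nuE nuw).
  rewrite -[RHS]/(term nu i); apply: kc_alt_idem => j.
  (* Here the parity of [w] enters: odd powers of a skew matrix are skew, so the entry is
     alternating in [j]. *)
  have Modd : odd (w - sumn nu) by rewrite oddB // w_odd (negbTE (even_partition_sumn nuE)).
  rewrite !ffunE tpermL tpermR -mulNr; congr (_ * _).
  have M_so : (A ^+ (w - sumn nu))^T = - A ^+ (w - sumn nu).
    by rewrite trmxX A_so exprNn -signr_odd Modd mulN1r.
  exact: skew_entry.
under eq_bigr do rewrite mulrCA.
rewrite -mulr_sumr; congr (_ * _).
under eq_bigr do rewrite mulr_sumr; rewrite exchange_big; apply: eq_bigr => n _.
under eq_bigr do rewrite mulr_sumr; rewrite exchange_big; apply: eq_bigr => u _ /=.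
under eq_bigr do rewrite mulrCA.
rewrite -mulr_sumr; congr (_ * _); under [LHS]eq_bigr do rewrite mulrA.
by rewrite -mulr_suml sum_tmul2.
Qed.

End KappaEvaluation.

(** * Partition sums as truncated exponentials *)

Section PartitionSums.

Lemma sum_count_mem (T : eqType) (s r : seq T) : uniq r -> {subset s <= r} ->
  (\sum_(x <- r) count_mem x s = size s)%N.
Proof.
move=> ru sr; under eq_bigr do rewrite -sum1_count big_mkcond.
rewrite exchange_big /= -sum1_size big_seq [RHS]big_seq; apply: eq_bigr => y ys.
rewrite -big_mkcond /= sum1_count.
by rewrite (eq_count (a2 := pred1 y)) ?count_uniq_mem ?sr // => x; rewrite /= eq_sym.
Qed.

(** The multinomial formula, by induction on the first letter [x] of a rearrangement: removing it
    takes a factor [count_mem x s] out of the product of factorials, and these factors add up to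
    [size s]. *)
Lemma size_permutations_mult (T : eqType) (s r : seq T) : uniq r -> {subset s <= r} ->
  (size (permutations s) * \prod_(x <- r) (count_mem x s)`! = (size s)`!)%N.
Proof.
move=> ru; have [n] := ubnP (size s); elim: n s => // n IH s sn sr.
have [s0|spos] := posnP (size s).
  have /size0nil-> := s0; rewrite big1 ?muln1 //; by move=> x _.
rewrite (perm_size (permutationsE spos)) size_allpairs_dep sumnE big_map big_distrl /=.
transitivity (\sum_(x <- undup s) count_mem x s * (size s).-1`!)%N; last first.
  rewrite -big_distrl /= sum_count_mem ?undup_uniq // => [|x]; last by rewrite mem_undup.
  by rewrite -[size s in RHS]prednK // factS prednK.
rewrite big_seq [RHS]big_seq; apply: eq_bigr => x; rewrite mem_undup => xs.
have sizer := size_rem xs.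
rewrite -sizer -(IH (rem x s)); first 1 last.
- by rewrite sizer; lia.
- by move=> y /mem_rem/sr.
rewrite mulnCA; congr (_ * _)%N.
rewrite (bigD1_seq x) ?sr //= [in RHS](bigD1_seq x) ?sr //= mulnA; congr (_ * _)%N.
  by rewrite count_rem xs /= eqxx subn1 -[in LHS](@prednK (count_mem x s)) ?factS ?prednK //
    -has_count has_pred1.
apply: eq_bigr => y yx; rewrite count_rem xs /= eq_sym (negbTE yx) subn0.
by [].
Qed.

(** Words are grouped by their sorted rearrangement; the fibre over [v] is the set of permutations
    of [v]. *)
Lemma sum_tuple_sorted (V : nmodType) (T : finType) (leT : rel T) n (Phi : seq T -> V) :
    total leT -> transitive leT -> antisymmetric leT ->
    (forall s t, perm_eq s t -> Phi s = Phi t) ->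
  \sum_(u : n.-tuple T) Phi u =
  \sum_(v : n.-tuple T | sorted leT v) Phi v *+ size (permutations v).
Proof.
move=> tot tr anti PhiP.
rewrite (partition_big (fun u : n.-tuple T => [tuple of sort leT u])
  (fun v : n.-tuple T => sorted leT v)) => [|u _]; last exact: sort_sorted.
apply: eq_bigr => v sv.
have sortE (u : n.-tuple T) : ([tuple of sort leT u] == v) = perm_eq u v.
  rewrite -val_eqE /= -[X in _ == X](sorted_sort tr sv).
  by apply/eqP/idP => /(perm_sortP tot tr anti).
rewrite (eq_bigl _ _ sortE) (eq_bigr (fun=> Phi v)) => [|u /PhiP //].
rewrite sumr_const cardE -(size_map val); congr (_ *+ _); apply: perm_size.
apply: uniq_perm; rewrite ?permutations_uniq ?(map_inj_uniq val_inj) ?enum_uniq // => t.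
rewrite mem_permutations; apply/mapP/idP => [[u] + ->|tv].
  by rewrite mem_enum.
have st : size t == n by rewrite (perm_size tv) size_tuple.
by exists (Tuple st); rewrite // mem_enum.
Qed.

Variable K : numFieldType.

Lemma polyX_tuples W n (g : nat -> K) :
  (\poly_(l < W.+1) g l) ^+ n =
  \sum_(u : n.-tuple 'I_W.+1) (\prod_(l <- map val u) g l) *: 'X^(sumn (map val u)).
Proof.
pose Phi (u : seq 'I_W.+1) := (\prod_(l <- map val u) g l) *: 'X^(sumn (map val u)).
rewrite -/(Phi _); elim: n => [|n IH].
  by rewrite (big_tuple0 Phi) /Phi big_nil scale1r.
rewrite exprS IH (big_tupleS _ Phi) poly_def big_distrlr /=.
apply: eq_bigr => x _; apply: eq_bigr => u _.
by rewrite /Phi /= big_cons -scalerAl -scalerAr scalerA exprD.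
Qed.

(** A partial sum of exp h. When [h] has zero constant coefficient, the omitted terms do not affect
    degrees up to [w]. *)
Definition trunc_exp w (h : {poly K}) : {poly K} :=
  \sum_(n < w.+1) n`!%:R^-1 *: h ^+ n.

(* A partition with [n] parts has [n! / prod m_nu(l)!] rearrangements, so the sum
   is over all words of length [n], with weight [1 / n!]. *)
Lemma partition_sum w (g : nat -> K) (Gam : {poly K}) :
    (forall l, ((0 < l)%N && ~~ odd l) = false -> g l = 0) ->
  (\sum_(n < w.+1)
  \sum_(u : n.-tuple 'I_w.+1 |
        let nu := map val u in even_partition nu && (sumn nu <= w)%N)
    let nu := map val u in
    (\prod_(1 <= l < (sumn nu).+1) (count_mem l nu)`!)%N%:R^-1 *
      (Gam`_(w - sumn nu) * \prod_(l <- nu) g l)) =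
  (Gam * trunc_exp w (\poly_(l < w.+1) g l))`_w.
Proof.
move=> g0; rewrite /trunc_exp mulr_sumr coef_sum; apply: eq_bigr => n _.
rewrite -scalerAr coefZ polyX_tuples mulr_sumr coef_sum.
pose Phi (u : seq 'I_w.+1) : K :=
  (Gam * ((\prod_(l <- map val u) g l) *: 'X^(sumn (map val u))))`_w.
rewrite -/(Phi _); pose leT (x y : 'I_w.+1) := geq x y.
rewrite (@sum_tuple_sorted _ _ leT n Phi); first last.
- move=> s t st; rewrite /Phi (perm_big (map val t)) ?perm_map //=.
  by rewrite (perm_sumn (perm_map _ st)).
- by move=> x y /andP[xy yx]; apply: val_inj; apply/eqP; rewrite eqn_leq; apply/andP.
- by move=> y x z xy yz; apply: leq_trans yz xy.
- by move=> x y; rewrite /leT /= leq_total.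
rewrite mulr_sumr big_mkcond [RHS]big_mkcond; apply: eq_bigr => u _ /=.
rewrite /even_partition sorted_map -/leT.
case: (boolP (sorted _ u)) => //= su.
have PhiE : Phi u = if (sumn (map val u) <= w)%N
    then Gam`_(w - sumn (map val u)) * \prod_(l <- map val u) g l else 0.
  rewrite /Phi -scalerAr coefZ coefMXn ltnNge.
  by case: leqP => _ /=; rewrite ?mulr0 // mulrC.
rewrite PhiE; case: leqP => uw; last by rewrite andbF mul0rn mulr0.
(* A word with a zero or odd part does occur on the right, but its weight vanishes by [g0]. *)
rewrite andbT; case: allP => [au|nall]; last first.
  suff -> : \prod_(l <- map val u) g l = 0 by rewrite mulr0 mul0rn mulr0.
  have /allPn[l lu /negbTE/g0 gl] : ~~ all (fun l => (0 < l)%N && ~~ odd l) (map val u).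
    exact/allP.
  by apply/eqP; rewrite prodf_seq_eq0; apply/hasP; exists l => //=; rewrite gl.
rewrite -[X in _ = _ * X]mulr_natl mulrA; congr (_ * _).
(* Both products have the same nontrivial factors: 0 is not a part, and no part exceeds the sum. *)
have prE : (\prod_(1 <= l < (sumn (map val u)).+1) (count_mem l (map val u))`! =
    \prod_(x <- enum 'I_w.+1) (count_mem x u)`!)%N.
  have cE (x : 'I_w.+1) : count_mem x u = count_mem (val x) (map val u).
    by rewrite count_map; apply: eq_count.
  under [RHS]eq_bigr do rewrite cE.
  rewrite big_enum /= -(big_mkord xpredT (fun l => (count_mem l (map val u))`!)).
  have c0 l : l \notin map val u -> (count_mem l (map val u))`! = 1%N by move/count_memPn->.
  have u_le l : l \in map val u -> (l <= sumn (map val u))%N.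
    by elim: (map val u) => //= a s IH; rewrite inE => /orP[/eqP->|/IH]; lia.
  rewrite [RHS]big_ltn // c0; last by apply/negP => /au.
  rewrite mul1n [RHS](@big_cat_nat _ _ _ (sumn (map val u)).+1) //=.
  rewrite [X in (_ * X)%N]big_nat [X in (_ * X)%N]big1 ?muln1 // => l /andP[lu _].
  by apply: c0; apply: contraL lu => /u_le; rewrite -leqNgt.
have := @size_permutations_mult _ u (enum 'I_w.+1) (enum_uniq _) (fun x _ => mem_enum _ x).
rewrite -prE size_tuple => nE.
have := fact_gt0 n; rewrite -nE muln_gt0 lt0n => /andP[p0 _].
by rewrite natrM invfM mulrAC mulVf ?mul1r // pnatr_eq0.
Qed.

End PartitionSums.

(** * The series of Tsymbaliuk *)

Section Jacobi.
Variable R : comNzRingType.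

Lemma deriv_prod_seq (I : eqType) (r : seq I) (F : I -> {poly R}) : uniq r ->
  (\prod_(i <- r) F i)^`() =
  \sum_(i <- r) \prod_(j <- r) (if j == i then (F j)^`() else F j).
Proof.
elim: r => [|x r IH] /=; first by rewrite !big_nil -[1]/(1%:P) derivC.
case/andP=> xr ru; rewrite big_cons derivM IH // [RHS]big_cons; congr (_ + _).
  rewrite big_cons eqxx; congr (_ * _); rewrite [LHS]big_seq [RHS]big_seq.
  by apply: eq_bigr => j jr; rewrite (negbTE (memPn xr j jr)).
rewrite mulr_sumr [LHS]big_seq [RHS]big_seq; apply: eq_bigr => i ir.
by rewrite big_cons eq_sym (negbTE (memPn xr i ir)).
Qed.

(** Jacobi's formula: the determinant is differentiated one row at a time. [Bi i] has row [i]
    differentiated, and its cofactors along that row are those of [B]. *)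
Lemma deriv_det m (B : 'M[{poly R}]_m) :
  (\det B)^`() = \tr (map_mx (@deriv R) B *m \adj B).
Proof.
pose Bi i := \matrix_(a, b) if a == i then (B a b)^`() else B a b.
transitivity (\sum_i \det (Bi i)).
  rewrite /determinant linear_sum /= exchange_big /=; apply: eq_bigr => s _.
  have sgnE (p : {poly R}) : ((-1) ^+ s * p)^`() = (-1) ^+ s * p^`().
    by case: (odd_perm s); rewrite ?expr0 ?expr1 ?mul1r ?mulN1r ?derivN.
  rewrite sgnE -mulr_sumr (deriv_prod_seq _ (index_enum_uniq _)); congr (_ * _).
  by apply: eq_bigr => i _; apply: eq_bigr => j _; rewrite mxE.
apply: eq_bigr => i _; rewrite (expand_det_row _ i) mxE; apply: eq_bigr => j _.
rewrite !mxE eqxx; congr (_ * _); congr (_ * \det _).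
by apply/matrixP => a b; rewrite !mxE eq_sym (negbTE (neq_lift _ _)).
Qed.

End Jacobi.

(** * Linear differential equations modulo powers of X *)

Section PowerSeriesODE.
Variable K : numFieldType.

Lemma coef_modX n (p q : {poly K}) : ('X^n %| p - q) ->
  forall k, (k < n)%N -> p`_k = q`_k.
Proof.
case/dvdpP => r pq k kn; apply/eqP; rewrite -subr_eq0 -coefB pq coefMXn kn.
by [].
Qed.

(** The equation expresses (k + 1) P_(k+1) through P_0, ..., P_k, and k + 1 is invertible in
    characteristic 0. *)
Lemma ode_unique n (S S' P Q : {poly K}) :
    ('X^n %| P^`() - S * P) -> ('X^n %| Q^`() - S' * Q) ->
    (forall k, (k < n)%N -> S`_k = S'`_k) -> P`_0 = Q`_0 ->
  forall k, (k <= n)%N -> P`_k = Q`_k.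
Proof.
move=> /coef_modX odeP /coef_modX odeQ SS' PQ0 k; have [N] := ubnP k.
elim: N k => // N IH [|k] // kN kn; apply: (@mulIf _ k.+1%:R); first by rewrite pnatr_eq0.
rewrite !mulr_natr -!coef_deriv odeP // odeQ // !coefM; apply: eq_bigr => i _.
have := ltn_ord i => ik; rewrite SS' ?IH //; lia.
Qed.

(** The defect is exactly - h' h^w / w!, and X divides [h]. *)
Lemma trunc_exp_ode w (h : {poly K}) : h`_0 = 0 ->
  'X^w %| (trunc_exp w h)^`() - h^`() * trunc_exp w h.
Proof.
move=> h0; have Xh : 'X %| h by rewrite -['X]subr0 dvdp_XsubCl rootE horner_coef0 h0.
have -> : (trunc_exp w h)^`() - h^`() * trunc_exp w h =
    - (w`!%:R^-1 *: h^`()) * h ^+ w.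
  rewrite /trunc_exp; elim: w => [|w IH].
    by rewrite big_ord1 expr0 fact0 invr1 !scale1r derivC sub0r !mulr1.
  rewrite big_ord_recr /= derivD mulrDr opprD addrACA IH derivZ deriv_exp.
  rewrite -[_ *+ w.+1]mulr_natl -pred_Sn.
  have -> : w`!%:R^-1 = w.+1%:R * (w.+1)`!%:R^-1 :> K.
    by rewrite factS natrM invfM mulVKf // pnatr_eq0.
  rewrite -!mul_polyC polyCM polyC_natr exprS.
  by ring.
by rewrite dvdp_mull // dvdp_exp2r.
Qed.

(** A partial sum of the binomial series of (1 + q)^a. *)
Definition trunc_pow a w (q : {poly K}) : {poly K} :=
  \sum_(j < w.+1) gbinom a j *: q ^+ j.

Lemma gbinomS (a : K) j : gbinom a j.+1 * j.+1%:R = (a - j%:R) * gbinom a j.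
Proof.
rewrite /gbinom big_ord_recr /= factS natrM invfM.
field.
by rewrite nat1r !pnatr_eq0 -!lt0n fact_gt0.
Qed.

(** The equation (1 + q) P' = a q' P of P = (1 + q)^a, with the exact remainder left by the
    truncation; successive remainders cancel by [gbinomS]. *)
Lemma trunc_pow_ode a w (q : {poly K}) :
  (1 + q) * (trunc_pow a w q)^`() - a *: q^`() * trunc_pow a w q =
  ((w%:R - a) * gbinom a w) *: (q^`() * q ^+ w).
Proof.
rewrite /trunc_pow; elim: w => [|w IH].
  rewrite big_ord1 /=; have -> : gbinom a 0 = 1 by rewrite /gbinom big_ord0 fact0 invr1 mulr1.
  by rewrite expr0 scale1r derivC mulr0 !sub0r !mulr1 scaleNr.
rewrite big_ord_recr /= derivD !mulrDr opprD addrACA IH derivZ deriv_exp.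
rewrite -[_ *+ w.+1]mulr_natl -pred_Sn.
have -> : (w%:R - a) * gbinom a w = - (w.+1%:R * gbinom a w.+1).
  by rewrite [w.+1%:R * _]mulrC gbinomS -mulNr opprB.
move: (gbinom a w.+1) => g.
rewrite -!mul_polyC polyCN !polyCM polyCB polyC_natr exprS.
by ring.
Qed.

Lemma ps_exp_coef (q : {poly K}) (f : nat -> K) : (forall n, f n = q`_n) ->
  forall j n, ps_exp f j n = (q ^+ j)`_n.
Proof.
move=> fE; elim=> [|j IH] n; first by rewrite expr0 coef1.
rewrite exprS coefM /ps_exp iterS /ps_mul.
by apply: eq_bigr => i _; rewrite fE -IH.
Qed.

(** The two truncations differ by terms with j > n, which vanish in degree [n] because X^j divides
    (p - 1)^j. *)
Lemma ps_pow_coef a w (p : {poly K}) n : (n <= w)%N -> p`_0 = 1 ->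
  ps_pow a (fun k => p`_k) n = (trunc_pow a w (p - 1))`_n.
Proof.
move=> nw p0; have Xq : 'X %| p - 1.
  by rewrite -['X]subr0 dvdp_XsubCl rootE horner_coef0 coefB coef1 p0 subrr.
rewrite /ps_pow /trunc_pow coef_sum.
rewrite (big_ord_widen w.+1 (fun j => gbinom a j *
  ps_exp (fun i => p`_i - ps_one K i) j n)) ?ltnS // big_mkcond; apply: eq_bigr => j _.
rewrite coefZ (@ps_exp_coef (p - 1)) => [|k]; last by rewrite coefB coef1.
case: ltnP => // nj; rewrite -[X in _ * X](_ : 0 = _) ?mulr0 //.
have /dvdpP[r ->] : 'X^j %| (p - 1) ^+ j by rewrite dvdp_exp2r.
by rewrite coefMXn nj.
Qed.

End PowerSeriesODE.

(** * The determinant and resolvent series of a matrix *)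

Section TsymbaliukSeries.
Variables (K : numFieldType) (m : nat) (A : 'M[K]_m).

(** With this sign 1 + tau^2 A^2 is 1 - tau^2 Y, and [mxY j] below is a term of its geometric
    series. *)
Let Y : 'M[K]_m := - (A *m A).
Let p : {poly K} := \det (one_plus_sqr A).
Let mxY j : 'M[{poly K}]_m := 'X^(j.*2) *: map_mx polyC (Y ^+ j).

Lemma one_plus_sqr_resolvent n :
  one_plus_sqr A *m (\sum_(j < n) mxY j) = 1%:M - mxY n.
Proof.
elim: n => [|n IH].
  by rewrite big_ord0 mulmx0 /mxY !expr0 scale1r map_mx1 subrr.
rewrite big_ord_recr /= mulmxDr IH -addrA; congr (_ + _).
rewrite /one_plus_sqr mulmxDl mul1mx addKr -scalemxAl /mxY -scalemxAr -map_mxM.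
rewrite scalerA -exprD -[(2 + _)%N]/(n.+1.*2).
have -> : A *m A *m Y ^+ n = - Y ^+ n.+1 by rewrite -[A *m A]opprK -/Y mulNmx exprS mulmxE.
by rewrite map_mxN scalerN.
Qed.

(** The logarithmic derivative of det (1 + tau^2 A^2)^(-1/2), truncated. *)
Let S w : {poly K} := \sum_(j < w.+1) \tr (Y ^+ j.+1) *: 'X^(j.*2.+1).

(** In Jacobi's formula the adjugate is replaced by [p] times the truncated geometric series, up to
    a multiple of X^(2(w + 1)). *)
Lemma det_one_plus_sqr_ode w :
  'X^w %| - 2%:R^-1 *: p^`() - S w * p.
Proof.
have dB : map_mx (@deriv K) (one_plus_sqr A) = ('X *+ 2) *: map_mx polyC (- Y).
  apply/matrixP => a b; rewrite !mxE derivD derivM derivXn derivC mulr0 addr0.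
  by rewrite opprK -polyCMn derivC add0r.
have adjE : \adj (one_plus_sqr A) =
    p *: (\sum_(j < w.+1) mxY j) + \adj (one_plus_sqr A) *m mxY w.+1.
  have := congr1 (mulmx (\adj (one_plus_sqr A))) (one_plus_sqr_resolvent w.+1).
  by rewrite mulmxA mul_adj_mx mul_scalar_mx mulmxBr mulmx1 => ->; rewrite subrK.
rewrite /p deriv_det -/p adjE mulmxDr linearD scalerDr addrAC /=.
have -> : - 2%:R^-1 *: \tr (map_mx (@deriv K) (one_plus_sqr A) *m
    (p *: \sum_(j < w.+1) mxY j)) = S w * p.
  rewrite dB -scalemxAr mxtraceZ [p * _]mulrC scalerAl; congr (_ * _).
  rewrite mulmx_sumr [\tr (\sum_(_ < _) _)]linear_sum scaler_sumr; apply: eq_bigr => j _ /=.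
  rewrite /mxY -scalemxAl -scalemxAr !mxtraceZ -map_mxM trace_map_mx mulNmx mulmxE -exprS.
  rewrite linearN /= polyCN -[X in X * (_ * _)]mulr_natl -polyC_natr -!mul_polyC.
  have half : (- 2%:R^-1)%:P * 2%:R%:P = - 1 :> {poly K}.
    by rewrite -polyCM mulNr mulVf ?pnatr_eq0 // polyCN.
  by rewrite !mulrA half !mulNr mul1r mulrN opprK mulrC -exprS.
rewrite subrr add0r /mxY -!scalemxAr linearZ /= scalerAr dvdp_mulr //.
by apply: dvdp_exp2l; lia.
Qed.

Lemma det_one_plus_sqr0 : p`_0 = 1.
Proof.
rewrite -horner_coef0 -horner_evalE /p -det_map_mx -[RHS](det1 K m); congr (\det _).
apply/matrixP => a b; rewrite !mxE /= horner_evalE hornerD hornerM hornerXn expr0n mul0r addr0.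
by case: (a == b); rewrite ?hornerE.
Qed.

(** Since [p] has constant coefficient 1 it is coprime to X^w, so the equation may be checked after
    multiplication by [p], where [trunc_pow_ode] applies. *)
Lemma det_inv_sqrt_ode w (P := trunc_pow (- 2%:R^-1) w (p - 1)) :
  'X^w %| P^`() - S w * P.
Proof.
have Xq : 'X %| p - 1.
  by rewrite -['X]subr0 dvdp_XsubCl rootE horner_coef0 coefB coef1 det_one_plus_sqr0 subrr.
have cop : coprimep 'X^w p.
  by rewrite coprimep_expl // coprimep_sym coprimepX rootE horner_coef0 det_one_plus_sqr0 oner_eq0.
rewrite -(Gauss_dvdpr _ cop).
have := trunc_pow_ode (- 2%:R^-1) w (p - 1); rewrite -/P [1 + _]addrC subrK derivB derivC subr0.
have [r rE] := dvdpP _ _ (det_one_plus_sqr_ode w).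
move=> odeP; have -> : p * (P^`() - S w * P) = r * P * 'X^w +
   ((w%:R - - 2%:R^-1) * gbinom (- 2%:R^-1) w) *: (p^`() * (p - 1) ^+ w).
  rewrite -odeP mulrBr.
  have /eqP := rE; rewrite subr_eq => /eqP ->.
  by ring.
by rewrite dvdp_add ?dvdp_mull // -mul_polyC !dvdp_mull ?dvdp_exp2r.
Qed.

(** The coefficients of - 1/2 log det (1 + tau^2 A^2). *)
Definition even_trace (l : nat) : K :=
  if (0 < l)%N && ~~ odd l then \tr (Y ^+ l./2) / l%:R else 0.

Lemma det_inv_sqrt_trunc_exp w n : (n <= w)%N ->
  det_inv_sqrt A n = (trunc_exp w (\poly_(l < w.+1) even_trace l))`_n.
Proof.
move=> nw; rewrite /det_inv_sqrt (@ps_pow_coef _ _ w) ?det_one_plus_sqr0 //.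
have h0 : (\poly_(l < w.+1) even_trace l)`_0 = 0 by rewrite coef_poly.
apply: ode_unique (det_inv_sqrt_ode w) (trunc_exp_ode w h0) _ _ _ nw => [k kw|].
  (* The factor k + 1 of the derivative cancels the denominator in [even_trace]; only odd [k] give
     nonzero terms, as in [S]. *)
  rewrite coef_deriv coef_poly ltnS kw /even_trace /= negbK coef_sum.
  under eq_bigr do rewrite coefZ coefXn.
  case: ifP => ko; last first.
    rewrite mul0rn big1 // => j _; case: eqP => [kE|]; last by rewrite mulr0.
    by move: ko; rewrite kE /= odd_double.
  have kE : k = (k./2).*2.+1 by rewrite -[LHS]odd_double_half ko.
  have jw : (k./2 < w.+1)%N by lia.
  rewrite (bigD1 (Ordinal jw)) //= -kE eqxx mulr1 big1 ?addr0.
    rewrite -[_ *+ k.+1]mulr_natr mulfVK ?pnatr_eq0 //; congr (\tr (_ ^+ _)); lia.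
  move=> j jk; case: eqP => [e|]; last by rewrite mulr0.
  by case/eqP: jk; apply: val_inj => /=; lia.
(* For the constant coefficients only the zeroth terms of the two sums count, and both are 1. *)
have coef0X (q : {poly K}) j : q`_0 = 0 -> (q ^+ j.+1)`_0 = 0.
  by move=> q0; rewrite exprS coefM big_ord1 q0 mul0r.
rewrite /trunc_pow /trunc_exp !coef_sum !big_ord_recl big1 => [|j _]; last first.
  by rewrite coefZ coef0X ?mulr0 // coefB coef1 det_one_plus_sqr0 subrr.
rewrite big1 => [|j _]; last by rewrite coefZ coef0X ?mulr0.
by rewrite !coefZ /= !expr0 /gbinom big_ord0 fact0 mul1r.
Qed.

Lemma ps_exp_monomial (f : nat -> 'M[K]_m) (B : 'M[K]_m) :
    (forall n, f n = if n == 2%N then B else 0) ->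
  forall j n, ps_exp f j n = if n == j.*2 then B ^+ j else 0.
Proof.
move=> fE; elim=> [|j IH] n; first by rewrite /ps_exp /= /ps_one; case: eqP.
rewrite /ps_exp iterS -/(ps_exp f j) /ps_mul.
case: (ltnP 1 n) => n2; last first.
  rewrite big1 => [|i _]; first by case: eqP => // ?; lia.
  by rewrite fE; case: eqP => [|_]; rewrite ?mul0r // => i2; have := ltn_ord i; lia.
have n2' : (2 < n.+1)%N by [].
rewrite (bigD1 (Ordinal n2')) //= big1 ?addr0 => [|i /negbTE i2]; last first.
  by rewrite fE -val_eqE /= in i2 *; rewrite i2 mul0r.
rewrite fE eqxx IH exprS.
have -> : (n - 2 == j.*2)%N = (n == j.+1.*2)%N by lia.
by case: ifP; rewrite ?mulr0.
Qed.

(** 1 - (1 + tau^2 A^2) is the monomial tau^2 Y, so each power in the geometric series lives in a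
    single degree. *)
Lemma resolventE n : resolvent A n = if odd n then 0 else Y ^+ n./2.
Proof.
rewrite /resolvent /ps_inv; under eq_bigr => j _.
  rewrite (@ps_exp_monomial _ Y) => [|k]; first over.
  apply/matrixP => a b; rewrite /ps_one !mxE /= coefD coefXnM -polyC_natr !coefC.
  case: k => [|[|[|k]]] /=; rewrite ?mxE ?mulr1n ?addr0 ?subrr ?sub0r ?oppr0 //.
  by rewrite add0r.
case: (boolP (odd n)) => no.
  by rewrite big1 // => j _; case: eqP => // e; rewrite e odd_double in no.
have nn : (n./2 < n.+1)%N by lia.
rewrite (bigD1 (Ordinal nn)) //= ifT; last by rewrite even_halfK.
rewrite big1 ?addr0 // => j /eqP jn; case: eqP => // e; case: jn.
by apply: val_inj => /=; lia.
Qed.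

(** The factor with the form is multiplied by tau, so that A Y^j sits in degree 2j + 1, its degree
    in [A]; the coefficient 2N becomes that of index [w]. *)
Lemma tsymbaliuk_seriesE N (v1 v2 : 'cV[K]_m) (w := N.*2.+1) :
  tsymbaliuk_series A v1 v2 N.*2 =
  (\poly_(k < w.+1) (if odd k then stdform v2 (A *m Y ^+ k./2 *m v1) else 0) *
   trunc_exp w (\poly_(l < w.+1) even_trace l))`_w.
Proof.
rewrite coefM big_ord_recl coef_poly /= mul0r add0r; apply: eq_bigr => a _.
have := ltn_ord a => aN; rewrite resolventE (@det_inv_sqrt_trunc_exp w) ?/w; last by lia.
rewrite coef_poly ltnS (ltn_ord a) /= /bump /= add1n subSS; congr (_ * _).
case: (boolP (odd a)) => ao /=; first by rewrite mulmx0 mul0mx /stdform mulmx0 mxE.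
by congr (stdform _ (_ *m _ ^+ _ *m _)); lia.
Qed.

(** Passing from even powers of [A] to powers of [Y] costs a sign. For a partition nu the path and
    the cycles give (-1)^((w - 1 - |nu|)/2 + |nu|/2), which is (-1)^N for every nu. *)
Lemma kappa_polyE N (v1 v2 : 'cV[K]_m) :
  kappa_poly A N.*2.+1 v1 v2 = (-1) ^+ N * tsymbaliuk_series A v1 v2 N.*2.
Proof.
set w := N.*2.+1; rewrite tsymbaliuk_seriesE.
rewrite -partition_sum; last by move=> l e; rewrite /even_trace e.
rewrite /kappa_poly mulr_sumr; apply: eq_bigr => n _.
rewrite mulr_sumr; apply: eq_bigr => u /andP[]; move: (map _ _) => nu nuE nuw.
have nuo := even_partition_sumn nuE.
rewrite /kappa_coef opprK expr1n div1r natrM invfM coef_poly ltnS leq_subr.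
have -> : odd (w - sumn nu) by rewrite oddB // (negbTE nuo) /= odd_double.
have powE k : A ^+ k.*2 = (-1) ^+ k *: Y ^+ k.
  elim: k => [|k IH]; first by rewrite !expr0 scale1r.
  rewrite doubleS !exprS mulrA IH -!mulmxE -scalemxAr -[A *m A]opprK -/Y mulNmx.
  by rewrite -scalerA scaleN1r scalerN.
have wk : (w - sumn nu)%N = ((w - sumn nu)./2).*2.+1 by rewrite /w in nuw *; lia.
have -> : A ^+ (w - sumn nu) *m v1 =
    (-1) ^+ (w - sumn nu)./2 *: (A *m Y ^+ (w - sumn nu)./2 *m v1).
  by rewrite {1}wk exprS powE -mulmxE -scalemxAr -scalemxAl.
have -> : \prod_(l <- nu) even_trace l =
   (\prod_(l <- nu) l)%N%:R^-1 * ((-1) ^+ (sumn nu)./2 * \prod_(l <- nu) \tr (A ^+ l)).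
  case/andP: nuE => _; elim: nu {nuw nuo wk} => [|l nu IH] /=.
    by rewrite !big_nil invr1 !mul1r.
  case/andP => l_ev nu_ev; rewrite !big_cons IH // /even_trace l_ev.
  have l2 : l = (l./2).*2 by case/andP: l_ev; lia.
  have -> : \tr (A ^+ l) = (-1) ^+ l./2 * \tr (Y ^+ l./2) by rewrite {1}l2 powE mxtraceZ.
  have -> : (l + sumn nu)./2 = (l./2 + (sumn nu)./2)%N by lia.
  have yy : (-1) ^+ l./2 * (-1) ^+ l./2 = 1 :> K by rewrite -expr2 sqrr_sign.
  rewrite natrM invfM exprD -[LHS]mul1r -[X in X * _ = _]yy.
  by ring.
have -> : (-1) ^+ N = (-1) ^+ (w - sumn nu)./2 * (-1) ^+ (sumn nu)./2 :> K.
  by rewrite -exprD; congr (_ ^+ _); rewrite /w in nuw *; lia.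
have yy : (-1) ^+ (sumn nu)./2 * (-1) ^+ (sumn nu)./2 = 1 :> K.
  by rewrite -expr2 sqrr_sign.
rewrite /stdform -scalemxAr mxE -[LHS]mul1r -[X in X * _ = _]yy.
by ring.
Qed.

End TsymbaliukSeries.

(** * Comparison of the specialized maps with the series *)

Theorem proposition7p9 (R : realType) (m N : nat) (F : specialization R[i] m) :
  exists2 c : R[i], c != 0 &
    forall (v1 v2 : 'cV[R[i]]_m) (A : 'M[R[i]]_m), so_mem A ->
      trace_poly
        (F _ _ (kappa m%:R (-1) N.*2.+1) (tmul2 (tvec v1) (tvec v2)))
        A
      = c * tsymbaliuk_series A v1 v2 N.*2.
Proof.
pose w := N.*2.+1.
(* The scalar of [trace_poly_kappa] times the sign of [kappa_polyE]; it depends on [N] only. *)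
exists (w`!%:R * 2%:R ^+ w * 2%:R * (-1) ^+ N) => [|v1 v2 A /eqP A_so].
  by rewrite !mulf_neq0 ?expf_neq0 ?oppr_eq0 ?oner_eq0 ?pnatr_eq0 // -lt0n fact_gt0.
rewrite specialization_unique trace_poly_kappa //; last by rewrite /= odd_double.
by rewrite kappa_polyE mulrA.
Qed.
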